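(* Let $\rho,\sigma$ be quantum states of rank at most $r$ and let $0\le\varepsilon_1<\varepsilon_2$ be reals. Given independent copies of $\rho$ and $\sigma$, there is a quantum algorithm that, with probability at least $2/3$, distinguishes the case $\mathrm{H}(\rho,\sigma)\le\varepsilon_1$ from the case $\mathrm{H}(\rho,\sigma)\ge\varepsilon_2$, using $O\!\left(\frac{r^{3.5}}{(\varepsilon_2-\varepsilon_1)^{20}}\log^4\frac{r}{\varepsilon_2-\varepsilon_1}\right)$ samples of $\rho$ and $\sigma$.
   Context: The quantum Hellinger distance is $\mathrm{H}(\rho,\sigma)=\sqrt{\tfrac12\operatorname{tr}\big((\sqrt\rho-\sqrt\sigma)^2\big)}=\sqrt{1-\operatorname{tr}(\sqrt\rho\sqrt\sigma)}$. A quantum algorithm with sample access applies a fixed quantum channel to $\rho^{\otimes k}\otimes\sigma^{\otimes l}$ (and ancillas) and measures; its sample complexity is $k+l$. *)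

(* Defs.v *)
From Stdlib Require Import Reals ClassicalEpsilon.
From HB Require Import structures.
From mathcomp Require Import all_boot all_order all_algebra.
From mathcomp Require Import complex mxtens.
From mathcomp Require Import Rstruct.
Set Implicit Arguments. Unset Strict Implicit. Unset Printing Implicit Defensive.
Import Order.TTheory GRing.Theory Num.Theory.
Local Open Scope ring_scope.

Notation Cplx := (complex R).

Definition adj {m n : nat} (A : 'M[Cplx]_(m, n)) : 'M[Cplx]_(n, m) :=
  (map_mx Num.conj A)^T.

Definition psd {n : nat} (A : 'M[Cplx]_n) : Prop :=
  forall v : 'cV[Cplx]_n, 0 <= (adj v *m A *m v) 0 0.

Definition density {n : nat} (A : 'M[Cplx]_n) : Prop := psd A /\ \tr A = 1.

(* the (unique) PSD square root of a PSD matrix (0 if A is not PSD) *)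
Definition psd_sqrt {n : nat} (A : 'M[Cplx]_n) : 'M[Cplx]_n :=
  epsilon (inhabits 0) (fun B : 'M[Cplx]_n => psd B /\ B *m B = A).

Definition hellinger {n : nat} (rho sigma : 'M[Cplx]_n) : R :=
  Num.sqrt (complex.Re (\tr ((psd_sqrt rho - psd_sqrt sigma) *m (psd_sqrt rho - psd_sqrt sigma))) / 2).

(* A quantum algorithm acting on an N-dimensional input system:
   an ancilla state tau, a quantum channel (Kraus operators K) from the
   system (input ⊗ ancilla) to an output system, and a two-outcome
   measurement {E, 1 - E} on the output (outcome E = "accept"). *)
Record qalg (N : nat) := QAlg {
  anc_dim : nat;
  anc : 'M[Cplx]_anc_dim;
  out_dim : nat;
  nkraus : nat;
  kraus : 'I_nkraus -> 'M[Cplx]_(out_dim, N * anc_dim);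
  effect : 'M[Cplx]_out_dim
}.
Arguments anc {N} q.
Arguments kraus {N} q i.
Arguments effect {N} q.

Definition qalg_valid (N : nat) (A : qalg N) : Prop :=
  density (anc A) /\
  \sum_(i < nkraus A) adj (kraus A i) *m kraus A i = 1%:M /\
  psd (effect A) /\ psd (1%:M - effect A).

Definition qalg_channel (N : nat) (A : qalg N) (X : 'M[Cplx]_N) : 'M[Cplx]_(out_dim A) :=
  \sum_(i < nkraus A) kraus A i *m (X *t anc A) *m adj (kraus A i).

Definition accept_prob (N : nat) (A : qalg N) (X : 'M[Cplx]_N) : R :=
  complex.Re (\tr (effect A *m qalg_channel A X)).

Definition hellinger_bound (r : nat) (delta : R) : R :=
  (r%:R ^+ 3 * Num.sqrt (r%:R)) / delta ^+ 20 * (ln (r%:R / delta)) ^+ 4.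

(* Main.v *)
Require Import Defs.
From Stdlib Require Import Reals.
From HB Require Import structures.
From mathcomp Require Import all_boot all_order all_algebra.
From mathcomp Require Import complex mxtens.
From mathcomp Require Import Rstruct ring lra zify.
Import Order.TTheory GRing.Theory Num.Theory.
Local Open Scope ring_scope.
Set Implicit Arguments.
Unset Strict Implicit.
Unset Printing Implicit Defensive.

(** Write F = tr(√ρ√σ), so that H² = 1 - F; since eps2² - eps1² ≥ δ² for δ = eps2 - eps1, it
    suffices to estimate F up to O(δ²).

    If S swaps two registers and c² + s² = 1, then c + isS is unitary and its partial trace against
    a fresh copy of ρ is exactly c + isρ.  Chaining such gates gives a unitary W on 1 + N copies of
    ρ and N copies of σ with tr(W ρ^⊗ σ^⊗) = tr(ρ P(ρ) Q(σ)) for any P, Q that are products of N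
    linear factors c + isx.  As (1 + W)^*(1 + W)/4 is an effect, the real part of this number is a
    sampling probability, and convex combinations of such P and Q cost nothing.

    To approximate √x by such combinations, let A_N be the N-th Taylor polynomial of √(1 - z).  All
    coefficients of A_N² - (1 - z) are nonnegative, with sum A_N(1)² = O(1/N), so A_N(z)² is within
    O(1/N) of 1 - z on the unit disc.  At z = c + isx with s = 1/K and N = K² this makes
    √(2/s) Re (A_N(z) - A_N(c)) an O(K^(-1/2))-approximation of √x on [0, 1].  Its total weight is
    O(1), and after division by x it is O(√K).  For states of rank at most r the error on F is
    O(√(r/K)), hence K ~ r/δ⁴; the statistics has range O(√K), so m ~ K/δ⁴ repetitions suffice
    by Chebyshev's inequality, and the number of samples is O(m K²) = O(r³/δ¹⁶). *)

(* Stdlib binds [R_scope] to [R], so that [+] and [*] would mean [Rplus] and [Rmult] in every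
   argument of type [R]. *)
Bind Scope ring_scope with R.

Local Notation "x %:C" := (real_complex R x).
(** * Truncated Taylor series of the square root *)

(* [cbinom n] is binom(2n, n) / 4^n, the n-th coefficient of 1/√(1 - z) and the sum of the first
   n + 1 coefficients [sqrt_coef] of √(1 - z). *)
Definition cbinom (n : nat) : R := \prod_(j < n) ((2 * j%:R + 1) / (2 * j%:R + 2)).

Lemma cbinomS n : cbinom n.+1 = cbinom n * ((2 * n%:R + 1) / (2 * n%:R + 2)).
Proof. by rewrite /cbinom big_ord_recr. Qed.

Lemma cbinom_gt0 n : 0 < cbinom n.
Proof.
by apply: prodr_gt0 => j _; apply: divr_gt0; have : 0 <= j%:R :> R by []; lra.
Qed.

Lemma cbinom_le n : cbinom n.+1 <= cbinom n.
Proof.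
have n0 : 0 <= n%:R :> R by [].
by rewrite cbinomS ler_piMr ?(ltW (cbinom_gt0 _)) // ler_pdivrMr; lra.
Qed.

(** The inductive step is (2n + 1)(2n + 3) <= (2n + 2)^2. The O(1/N) error of the truncated series
    comes from this bound. *)
Lemma cbinom_sqr n : cbinom n ^+ 2 * (2 * n%:R + 1) <= 1.
Proof.
elim: n => [|n IH]; first by rewrite /cbinom big_ord0 expr1n mul1r; lra.
apply: le_trans IH; rewrite cbinomS.
have y0 : 0 <= n%:R :> R by [].
rewrite -(natr1 n); move: (n%:R : R) y0 (cbinom n) => y y0 b.
rewrite exprMn -mulrA ler_wpM2l ?sqr_ge0 //.
have y2 : 0 < 2 * y + 2 by lra.
by rewrite expr_div_n mulrAC ler_pdivrMr ?exprn_gt0 //; nra.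
Qed.

(** For n > 0 both sides are the coefficient of z^(n-1) in (1 - z)^(-3/2). *)
Lemma sum_cbinom n : \sum_(j < n) cbinom j = 2 * n%:R * cbinom n.
Proof.
elim: n => [|n IH]; first by rewrite big_ord0 mulr0 mul0r.
rewrite big_ord_recr IH /= cbinomS -natr1.
have n0 : 0 <= n%:R :> R by rewrite ler0n.
by field; lra.
Qed.

Definition sqrt_coef (n : nat) : R := if n is m.+1 then cbinom m.+1 - cbinom m else 1.

Arguments sqrt_coef : simpl never.

Lemma sqrt_coef_le0 n : sqrt_coef n.+1 <= 0.
Proof. by rewrite subr_le0 cbinom_le. Qed.

(** Coefficientwise, the derivative of √(1 - z) is -1/(2 √(1 - z)). Together with [sum_cbinom] this
    sums the weights n |a_n|. *)
Lemma sqrt_coef_mul n : n.+1%:R * - sqrt_coef n.+1 = cbinom n / 2.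
Proof.
rewrite /sqrt_coef cbinomS -natr1.
have n0 : 0 <= n%:R :> R by rewrite ler0n.
by field; lra.
Qed.

Lemma sqrt_coefS n : 2 * n.+1%:R * sqrt_coef n.+1 = (2 * n%:R - 1) * sqrt_coef n.
Proof.
case: n => [|n]; first by rewrite /sqrt_coef cbinomS /cbinom big_ord0; field.
rewrite /sqrt_coef !cbinomS -!natr1.
have n0 : 0 <= n%:R :> R by rewrite ler0n.
by field; lra.
Qed.

Lemma sum_sqrt_coef n : \sum_(j < n.+1) sqrt_coef j = cbinom n.
Proof.
elim: n => [|n IH]; first by rewrite big_ord1 /sqrt_coef /cbinom ?big_ord0.
by rewrite big_ord_recr IH /= addrC subrK.
Qed.

Definition sqrt_poly (N : nat) : {poly R} := \poly_(n < N.+1) sqrt_coef n.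

(* The truncation of the equation 2 (1 - z) A' + A = 0 satisfied by A = √(1 - z). *)
Lemma sqrt_poly_ode N : (1 - 'X) * (sqrt_poly N)^`() *+ 2 + sqrt_poly N =
  ((1 - 2 * N%:R) * sqrt_coef N) *: 'X^N.
Proof.
apply/polyP => m; rewrite coefZ coefXn coefD coefMn mulrBl mul1r coefB coefXM.
rewrite !coef_deriv !coef_poly !ltnS.
have := sqrt_coefS m; case: (ltngtP m N) => h.
- rewrite mulr0; case: m h => [|m] h /=.
    by rewrite mulr0 sub0r mulr1n subr0 mulr1 -mulr_natr => E; lra.
  rewrite (ltnW h) -(mulr_natr (_ - _)) -(mulr_natr (sqrt_coef m.+2)) -(mulr_natr (sqrt_coef m.+1)).
  move: (sqrt_coef m.+2) (sqrt_coef m.+1) (m.+2%:R : R) (m.+1%:R : R) => x y p q E.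
  by transitivity (2 * p * x - (2 * q - 1) * y); [ring | rewrite E subrr].
- case: m h => // m; rewrite ltnS => h; rewrite ltnNge h /=.
  by rewrite !mul0rn mulr0 subr0 mul0rn addr0.
- rewrite h mul0rn; case: N {h} => [|N] _ /=.
    by rewrite mulr0 !subr0 mul0rn add0r mul1r mulr1.
  rewrite leqnn -(mulr_natr (0 - _)) -(mulr_natr (sqrt_coef N.+1)); ring.
Qed.

(* By the equation above, the coefficients d_m of A² satisfy (m + 1) d_(m+1) = (m - 1) d_m for
   m < N. *)
Lemma sqrt_poly_sqr_low N m : (m <= N)%N ->
  (sqrt_poly N ^+ 2)`_m = (m == 0%N)%:R - (m == 1%N)%:R.
Proof.
set D := sqrt_poly N ^+ 2.
have ode : (1 - 'X) * D^`() + D = ((1 - 2 * N%:R) * sqrt_coef N) *: (sqrt_poly N * 'X^N).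
  by rewrite scalerAr -sqrt_poly_ode /D !expr2 derivM; ring.
elim: m => [_|m IH mN].
  by rewrite /D expr2 coef0M coef_poly /= mulr1 subr0.
move/polyP/(_ m): ode; rewrite coefZ coefMXn mN mulr0 coefD mulrBl mul1r coefB.
rewrite coefXM !coef_deriv (IH (ltnW mN)).
case: m mN IH => [|m] mN IH /=.
  by rewrite ?subr0 ?sub0r mulr1n => h; lra.
have -> : D`_m.+1 = (m.+1 == 0%N)%:R - (m.+1 == 1%N)%:R by apply: IH; apply: ltnW.
have m0 : 0 <= m%:R :> R by [].
rewrite /= -(mulr_natl D`_m.+2) -(mulr_natl (_ - _)) -!natr1.
case: m mN IH m0 => [|m] mN IH m0 /= h; first by lra.
suff : (m.+1%:R + 2) * D`_m.+3 = 0.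
  by move/eqP; rewrite mulf_eq0 => /orP[/eqP|/eqP ->]; rewrite ?subr0 //; lra.
by lra.
Qed.

(** Two indices that are at most N and add up to m > N are both positive, so every product in the
    convolution is one of two nonpositive coefficients. *)
Lemma sqrt_poly_sqr_high N m : (N < m)%N -> 0 <= (sqrt_poly N ^+ 2)`_m.
Proof.
move=> Nm; rewrite expr2 coefM; apply: sumr_ge0 => j _; rewrite !coef_poly.
case: ifP => [jN|_]; last by rewrite mul0r.
case: ifP => [mjN|_]; last by rewrite mulr0.
case: (val j) (ltn_ord j) jN mjN => [|i] ij jN mjN; first by lia.
have -> : (m - i.+1 = (m - i.+1).-1.+1)%N by lia.
by rewrite -mulrNN mulr_ge0 // oppr_ge0 sqrt_coef_le0.
Qed.

Lemma sqrt_poly1 N : (sqrt_poly N).[1] = cbinom N.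
Proof.
by rewrite horner_poly -sum_sqrt_coef; apply: eq_bigr => i _; rewrite expr1n mulr1.
Qed.

Definition sqrt_trunc (N : nat) (z : Cplx) : Cplx := \sum_(n < N.+1) (sqrt_coef n)%:C * z ^+ n.

Lemma sqrt_truncE N z : sqrt_trunc N z = (map_poly (real_complex R) (sqrt_poly N)).[z].
Proof.
rewrite (@horner_coef_wide _ N.+1); last by rewrite size_map_poly size_poly.
by apply: eq_bigr => i _; rewrite coef_map coef_poly ltn_ord.
Qed.

(** The difference A^2 - (1 - z) has only terms of degree above N, with nonnegative coefficients. On
    the unit disc it is therefore largest at z = 1, where it equals A(1)^2. *)
Lemma sqrt_trunc_sqr N z : (0 < N)%N -> `|z| <= 1 ->
  `|sqrt_trunc N z ^+ 2 - (1 - z)| <= (cbinom N ^+ 2)%:C.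
Proof.
move=> N0 z1; rewrite sqrt_truncE -horner_exp -rmorphXn /=.
set D := sqrt_poly N ^+ 2.
have szD : (size D <= N.+1 + N.+1)%N.
  apply: leq_trans (size_polyMleq _ _) _.
  have : (size (sqrt_poly N) <= N.+1)%N by apply: size_poly.
  by lia.
have split2 (F : zmodType) (f : nat -> F) :
    \sum_(i < N.+1 + N.+1) f i = f 0%N + f 1%N + \sum_(2 <= i < N.+1) f i
       + \sum_(N.+1 <= i < N.+1 + N.+1) f i.
  rewrite -(big_mkord xpredT f) (@big_cat_nat _ _ _ N.+1) ?leq_addr //=.
  by rewrite big_ltn // big_ltn ?ltnS // addrA.
have low (i : nat) : (2 <= i < N.+1)%N -> D`_i = 0.
  rewrite ltnS => /andP[i2 iN]; rewrite sqrt_poly_sqr_low //.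
  by case: i i2 iN => [|[|i]] // _ _; rewrite subrr.
have D0 : D`_0 = 1 by rewrite sqrt_poly_sqr_low //= subr0.
have D1 : D`_1 = -1 by rewrite sqrt_poly_sqr_low //= sub0r.
have -> : (cbinom N ^+ 2)%:C = (\sum_(N.+1 <= i < N.+1 + N.+1) D`_i)%:C.
  (* At z = 1 the low part 1 - z vanishes, so A(1)^2 is the sum of the high coefficients. *)
  congr (_%:C); rewrite -sqrt_poly1 -horner_exp -/D (horner_coef_wide _ szD).
  under eq_bigr do rewrite expr1n mulr1.
  rewrite (split2 _ (fun i => D`_i)) D0 D1 subrr add0r.
  by rewrite big_nat big1 ?add0r // => i /low.
rewrite (@horner_coef_wide _ (N.+1 + N.+1)) ?size_map_poly //.
rewrite (split2 _ (fun i => (map_poly (real_complex R) D)`_i * z ^+ i)).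
rewrite !coef_map /= D0 D1 [X in _ + _ + X + _]big_nat big1 => [|i /low]; last first.
  by rewrite coef_map /= => ->; rewrite rmorph0 mul0r.
rewrite rmorphN rmorph1 !expr1 expr0 mulr1 mulN1r addr0 [X in X - _]addrC addrK.
rewrite rmorph_sum /= !big_nat; apply: le_trans (ler_norm_sum _ _ _) _.
apply: ler_sum => i /andP[Ni _]; rewrite coef_map /= normrM normrX.
have d0 : 0 <= (D`_i)%:C by rewrite ler0c sqrt_poly_sqr_high.
by rewrite (ger0_norm d0) ler_piMr // exprn_ile1.
Qed.

(** * Real parts of the truncated series and the approximation error *)

Lemma ReB (z w : Cplx) : complex.Re (z - w) = complex.Re z - complex.Re w.
Proof. by case: z w => [a b] [c d]. Qed.

Lemma ReD (z w : Cplx) : complex.Re (z + w) = complex.Re z + complex.Re w.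
Proof. by case: z w => [a b] [c d]. Qed.

Lemma ReZ (t : R) (z : Cplx) : complex.Re (t%:C * z) = t * complex.Re z.
Proof. by case: z => a b /=; rewrite mul0r subr0. Qed.

Lemma Re_sum (I : Type) (r : seq I) (P : pred I) (f : I -> Cplx) :
  complex.Re (\sum_(i <- r | P i) f i) = \sum_(i <- r | P i) complex.Re (f i).
Proof. by elim/big_rec2: _ => // i y1 y2 _ <-; rewrite ReD. Qed.

Lemma le_of_sqr (x b : R) : 0 <= b -> x ^+ 2 <= b ^+ 2 -> x <= b.
Proof. by move=> b0; case: lerP => // bx h; nra. Qed.

Lemma normC_le (z : Cplx) (e : R) :
  (`|z| <= e%:C) = (0 <= e) && (complex.Re z ^+ 2 + complex.Im z ^+ 2 <= e ^+ 2).
Proof.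
rewrite normc_def lecR; apply/idP/andP => [h|[e0 h]].
  have e0 : 0 <= e by apply: le_trans h; apply: sqrtr_ge0.
  split=> //; rewrite -[X in X <= _]sqr_sqrtr ?addr_ge0 ?sqr_ge0 //.
  by rewrite ler_sqr ?nnegrE ?sqrtr_ge0.
by rewrite -(ger0_norm e0) -sqrtr_sqr ler_wsqrtr.
Qed.

(** All coefficients after the first are nonpositive, so on the disc Re A(z) >= A(1) > 0. This fixes
    the sign of the root when a bound on the square of the real part is turned into one on the real
    part. *)
Lemma sqrt_trunc_Re_ge0 N (z : Cplx) : `|z| <= 1 -> 0 <= complex.Re (sqrt_trunc N z).
Proof.
move=> z1; apply: le_trans (ltW (cbinom_gt0 N)) _.
rewrite -sum_sqrt_coef /sqrt_trunc Re_sum; apply: ler_sum => -[[|n] ?] _ /=.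
  by rewrite mulr1 mul0r subr0.
rewrite ReZ -[X in X <= _]mulr1; apply: ler_wnM2l; first exact: sqrt_coef_le0.
have : `|z ^+ n.+1| <= 1 by rewrite normrX exprn_ile1.
rewrite -[1]/(1%:C) normC_le => /andP[_ h].
have := sqr_ge0 (complex.Im (z ^+ n.+1)); nra.
Qed.

Lemma cnum_norm (c s x : R) : c ^+ 2 + s ^+ 2 = 1 -> 0 <= x <= 1 ->
  `|Complex c (s * x)| <= 1.
Proof.
move=> cs /andP[x0 x1]; rewrite -[1]/(1%:C) normC_le ler01 /= expr1n -cs.
rewrite lerD2l exprMn ler_piMr ?sqr_ge0 //; nra.
Qed.

(** For A = u + iv one has 2 u^2 = |A^2| + Re A^2, and A^2 is close to 1 - c - i s x, hence to -i s
    x. The error is at most [cbinom N] ^+ 2 + (1 - c) <= s^2 / 2 + s^2. *)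
Lemma sqrt_trunc_Re_sqr N (c s x : R) : c ^+ 2 + s ^+ 2 = 1 -> 0 <= c -> 0 <= s ->
  s ^+ 2 * N%:R = 1 -> 0 <= x <= 1 ->
  `|complex.Re (sqrt_trunc N (Complex c (s * x))) ^+ 2 - s * x / 2| <= 3 / 2 * s ^+ 2.
Proof.
move=> cs c0 s0 sN x01; have z1 := cnum_norm cs x01.
have N0 : (0 < N)%N by case: N sN => //; rewrite mulr0 => /esym/eqP; rewrite oner_eq0.
have := sqrt_trunc_sqr N0 z1; rewrite normC_le sqr_ge0 /=.
case: (sqrt_trunc _ _) => u v /=.
have bb : cbinom N ^+ 2 <= s ^+ 2 / 2.
  have := cbinom_sqr N; set b := cbinom N ^+ 2 => bN.
  have b0 : 0 <= b by apply: sqr_ge0.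
  have n0 : 0 < N%:R :> R by rewrite ltr0n.
  rewrite -(ler_pM2r n0) (mulrAC (s ^+ 2)) sN; lra.
have cc : 1 - c <= s ^+ 2 by nra.
have cc0 : 0 <= 1 - c by nra.
move: (cbinom N ^+ 2) (sqr_ge0 (cbinom N)) bb => b b0 bb h.
move: x01 => /andP[x0 _]; have y0 : 0 <= s * x by apply: mulr_ge0.
move: (s * x) y0 h => y y0 h.
set p := u ^+ 2 - v ^+ 2; set q := 2 * u * v + y.
have {h} h : (p - (1 - c)) ^+ 2 + q ^+ 2 <= b ^+ 2.
  by move: h; rewrite /p /q; congr (_ <= _); ring.
pose e := b + (1 - c).
have e0 : 0 <= e by rewrite /e addr_ge0.
have {}h : p ^+ 2 + q ^+ 2 <= e ^+ 2.
  have : p - (1 - c) <= b by apply: le_of_sqr b0 _; nra.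
  rewrite /e; nra.
have he : e <= 3 / 2 * s ^+ 2 by rewrite /e; lra.
apply: le_trans he; clear bb cc cc0 b0.
(* Here r = |A|^2 = |A^2|, with p and q - y the real and imaginary parts of A^2 up to the sign of y
   - q; it remains to place r within e of y. *)
pose r := u ^+ 2 + v ^+ 2.
have r0 : 0 <= r by rewrite /r addr_ge0 ?sqr_ge0.
have r2 : r ^+ 2 = p ^+ 2 + (q - y) ^+ 2 by rewrite /r /p /q; ring.
have u2 : 2 * u ^+ 2 = r + p by rewrite /r /p; ring.
have pe : `|p| <= e by apply: le_of_sqr e0 _; rewrite real_normK ?num_real //; nra.
have qe : `|q| <= e by apply: le_of_sqr e0 _; rewrite real_normK ?num_real //; nra.
move: pe qe; rewrite !ler_norml => /andP[p1 p2] /andP[q1 q2].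
have ru : r <= y + e by apply: le_of_sqr; nra.
have rl : y - e <= r.
  case: (lerP (y - e) 0) => ye; first exact: le_trans ye r0.
  by apply: le_of_sqr r0 _; nra.
by apply/andP; split; lra.
Qed.

(** For nonnegative u and w, |u - w| <= u + w, so |u - w|^2 <= |u^2 - w^2|. *)
Lemma dist_of_sqr (u w e : R) : 0 <= u -> 0 <= w -> `|u ^+ 2 - w ^+ 2| <= e -> `|u - w| <= Num.sqrt e.
Proof.
move=> u0 w0 h; rewrite -sqrtr_sqr ler_wsqrtr //; apply: le_trans h.
rewrite subr_sqr normrM -[X in X <= _]ger0_norm ?sqr_ge0 // expr2 normrM.
apply: ler_wpM2l => //; rewrite [X in _ <= X]ger0_norm ?addr_ge0 //.
by rewrite ler_norml; apply/andP; split; lra.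
Qed.

(** Subtracting the value at x = 0 makes the function vanish there: zero eigenvalues then contribute
    no error, and a factor x can be split off. The prefactor inverts the scale √(s / 2) of the real
    part. *)
Definition sqrt_approx (c s : R) (N : nat) (x : R) : R :=
  Num.sqrt (2 / s) * (complex.Re (sqrt_trunc N (Complex c (s * x)))
                    - complex.Re (sqrt_trunc N (Complex c 0))).

Lemma sqrt_approx_err N (c s a : R) : c ^+ 2 + s ^+ 2 = 1 -> 0 <= c -> 0 < s ->
  s ^+ 2 * N%:R = 1 -> 0 <= a <= 1 ->
  `|sqrt_approx c s N (a ^+ 2) - a| <= 4 * Num.sqrt s.
Proof.
move=> cs c0 s0 sN /andP[a0 a1].
(* The scaled real part without the subtraction is within √(3 s) <= 2 √s of b. The two uses, at b =
   a and at b = 0, add up to 4 √s. *)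
have main (b : R) : 0 <= b <= 1 ->
    `|Num.sqrt (2 / s) * complex.Re (sqrt_trunc N (Complex c (s * b ^+ 2))) - b| <= 2 * Num.sqrt s.
  move=> /andP[b0 b1]; have b01 : 0 <= b ^+ 2 <= 1 by rewrite sqr_ge0 exprn_ile1.
  have h := sqrt_trunc_Re_sqr cs c0 (ltW s0) sN b01.
  have u0 := sqrt_trunc_Re_ge0 N (cnum_norm cs b01).
  move: (complex.Re _) u0 h => u u0 h.
  have s2 : 0 <= s / 2 by rewrite divr_ge0 ?ltW.
  have w0 : 0 <= Num.sqrt (s / 2) * b by rewrite mulr_ge0 ?sqrtr_ge0.
  have : `|u - Num.sqrt (s / 2) * b| <= Num.sqrt (3 / 2 * s ^+ 2).
    by apply: dist_of_sqr => //; rewrite exprMn sqr_sqrtr // mulrAC.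
  have l0 : 0 <= Num.sqrt (2 / s) by apply: sqrtr_ge0.
  move=> /(ler_wpM2l l0); rewrite -{1}(ger0_norm l0) -normrM mulrBr mulrA.
  have ss : 0 <= 2 / s by rewrite divr_ge0 ?ltW.
  rewrite -!sqrtrM //; have -> : 2 / s * (s / 2) = 1 by field; lra.
  rewrite sqrtr1 mul1r => /le_trans; apply.
  have -> : 2 / s * (3 / 2 * s ^+ 2) = 3 * s by field; lra.
  rewrite sqrtrM // ler_wpM2r ?sqrtr_ge0 //.
  rewrite -(ler_pXn2r (n := 2)) ?nnegrE ?sqrtr_ge0 // sqr_sqrtr //; lra.
have h1 := main a; have h0 := main 0.
move: h1 h0; rewrite lexx ler01 a0 a1 expr0n /= mulr0 subr0 => /(_ isT) h1 /(_ isT) h0.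
rewrite /sqrt_approx mulrBr addrAC; apply: le_trans (ler_normB _ _) _.
by apply: le_trans (lerD h1 h0) _; lra.
Qed.
(** * Functions realizable by swap gates *)

Definition lprod (cs : seq (R * R)) (x : R) : Cplx :=
  \prod_(t <- cs) Complex t.1 (t.2 * x).

Definition unitary_coefs (cs : seq (R * R)) : bool :=
  all (fun t : R * R => t.1 ^+ 2 + t.2 ^+ 2 == 1) cs.

(* [hull n a M]: [a] is a combination of products of [n] unitary linear factors whose coefficients
   have absolute values summing to [M]; the factors [Complex 0 1] are free because an observable is
   sampled up to an arbitrary phase. *)
Inductive hull (n : nat) : (R -> Cplx) -> R -> Prop :=
| hull_lprod cs : size cs = n -> unitary_coefs cs -> hull n (lprod cs) 1
| hull_add a b M M' : hull n a M -> hull n b M' -> hull n (fun x => a x + b x) (M + M')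
| hull_scale t a M : 0 <= t -> hull n a M -> hull n (fun x => t%:C * a x) (t * M)
| hull_i a M : hull n a M -> hull n (fun x => Complex 0 1 * a x) M
| hull_ext a b M : a =1 b -> hull n a M -> hull n b M.

Lemma hull_opp n a M : hull n a M -> hull n (fun x => - a x) M.
Proof.
move=> h; apply: hull_ext (hull_i (hull_i h)) => x.
by rewrite mulrA -expr2 sqr_i mulN1r.
Qed.

Lemma hull_scaleR n (t : R) a M : hull n a M -> hull n (fun x => t%:C * a x) (`|t| * M).
Proof.
move=> h; case: (ger0P t) => t0; first exact: hull_scale.
apply: hull_ext (hull_opp (hull_scale (ltW _ : 0 <= - t) h)); last by rewrite oppr_gt0.
by move=> x; rewrite rmorphN mulNr opprK.
Qed.

Lemma lprod_nseq n (t : R * R) x : lprod (nseq n t) x = Complex t.1 (t.2 * x) ^+ n.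
Proof.
rewrite /lprod; elim: n => [|n IH]; first by rewrite big_nil expr0.
by rewrite /= big_cons IH exprS.
Qed.

Lemma unitary_nseq n (t : R * R) :
  t.1 ^+ 2 + t.2 ^+ 2 = 1 -> unitary_coefs (nseq n t).
Proof. by move=> h; rewrite /unitary_coefs all_nseq h eqxx orbT. Qed.

(** Missing factors are filled up with the pair (1, 0), whose value is constantly 1. *)
Lemma hull_pow n j (c s : R) : (j <= n)%N -> c ^+ 2 + s ^+ 2 = 1 ->
  hull n (fun x => Complex c (s * x) ^+ j) 1.
Proof.
move=> jn cs; pose l := nseq j (c, s) ++ nseq (n - j) (1 : R, 0 : R).
have lu : unitary_coefs l.
  rewrite /unitary_coefs all_cat; apply/andP; split; apply: unitary_nseq => //=.
  by rewrite expr1n expr0n addr0.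
have sl : size l = n by rewrite size_cat !size_nseq subnKC.
apply: hull_ext (hull_lprod sl lu) => x.
rewrite /lprod big_cat /= -/(lprod _ x) -/(lprod _ x) !lprod_nseq /=.
by rewrite mul0r -[Complex 1 0]/(1 : Cplx) expr1n mulr1.
Qed.

(** The pair (0, 1) has the value i x, and the free phase -i turns it into x. It occupies one of the
    n factors, hence j < n. *)
Lemma hull_Xpow n j (c s : R) : (j < n)%N -> c ^+ 2 + s ^+ 2 = 1 ->
  hull n (fun x => x%:C * Complex c (s * x) ^+ j) 1.
Proof.
move=> jn cs.
pose l := (0 : R, 1 : R) :: nseq j (c, s) ++ nseq (n - j.+1) (1 : R, 0 : R).
have lu : unitary_coefs l.
  rewrite /unitary_coefs /= all_cat expr1n expr0n add0r eqxx /=.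
  apply/andP; split; apply: unitary_nseq => //=.
  by rewrite expr1n expr0n addr0.
have sl : size l = n by rewrite /= size_cat !size_nseq -addSn subnKC.
apply: hull_ext (hull_opp (hull_i (hull_lprod sl lu))) => x.
rewrite /lprod big_cons big_cat /= -/(lprod _ x) -/(lprod _ x) !lprod_nseq /=.
rewrite mul0r -[Complex 1 0]/(1 : Cplx) expr1n mulr1 mul1r mulrA -mulNr.
by congr (_ * _); rewrite [Complex 0 x]complexE /= add0r mulrA -expr2 sqr_i mulN1r opprK.
Qed.

Lemma hull0 n : hull n (fun=> 0) 0.
Proof.
have cs : (1 : R) ^+ 2 + 0 ^+ 2 = 1 by rewrite expr1n expr0n addr0.
have := hull_scale (lexx 0) (hull_pow (leq0n n) cs); rewrite mul0r.
by apply: hull_ext => x; rewrite rmorph0 mul0r.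
Qed.

(** Spare weight is spent on two opposite constants, which cancel. *)
Lemma hull_mono n a M M' : M <= M' -> hull n a M -> hull n a M'.
Proof.
move=> MM h; pose t := (M' - M) / 2.
have t0 : 0 <= t by rewrite divr_ge0 ?subr_ge0.
have cs : (1 : R) ^+ 2 + 0 ^+ 2 = 1 by rewrite expr1n expr0n addr0.
have h1 := hull_scale t0 (hull_pow (leq0n n) cs).
have -> : M' = M + (t * 1 + t * 1) by rewrite /t; field.
by apply: hull_ext (hull_add h (hull_add h1 (hull_opp h1))) => x; rewrite subrr addr0.
Qed.

Lemma hull_sum n (I : Type) (r : seq I) (P : pred I) (a : I -> R -> Cplx) (M : I -> R) :
  (forall i, P i -> hull n (a i) (M i)) ->
  hull n (fun x => \sum_(i <- r | P i) a i x) (\sum_(i <- r | P i) M i).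
Proof.
move=> h; elim: r => [|i r IH].
  by rewrite big_nil; apply: hull_ext (hull0 n) => x; rewrite big_nil.
rewrite big_cons; case Pi: (P i); last first.
  by apply: hull_ext IH => x; rewrite big_cons Pi.
by apply: hull_ext (hull_add (h _ Pi) IH) => x; rewrite big_cons Pi.
Qed.

(** * Weights of the square-root approximation and of its quotient by x *)

Definition geom_sum (c s : R) (n : nat) (x : R) : Cplx :=
  \sum_(j < n) (c ^+ (n.-1 - j))%:C * Complex c (s * x) ^+ j.

(** With z = c + i s x, c - z = -i s x, so factoring c - z out of c^n - z^n exhibits a factor x. *)
Lemma geom_sum_diff (c s : R) n x :
  (c ^+ n)%:C - Complex c (s * x) ^+ n = - (s%:C * (Complex 0 1 * (x%:C * geom_sum c s n x))).
Proof.
rewrite rmorphXn subrXX mulrA mulrA -mulNr; congr (_ * _).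
  rewrite [Complex c _]complexE /= rmorphM; ring.
by apply: eq_bigr => j _; rewrite rmorphXn.
Qed.

Section Cost.
Variables (N : nat) (c s : R).
Hypotheses (cs : c ^+ 2 + s ^+ 2 = 1) (c0 : 0 <= c).

Let c1 : c <= 1.
Proof. by apply: (@le_of_sqr c 1 ler01); rewrite expr1n -cs lerDl sqr_ge0. Qed.

Lemma hull_geom_sum n : (n <= N.+1)%N -> hull N (geom_sum c s n) n%:R.
Proof.
move=> nN; have -> : n%:R = \sum_(j < n) 1 :> R by rewrite sumr_const card_ord.
apply: hull_sum => j _; have jN : (j <= N)%N by rewrite -ltnS (leq_trans _ nN).
apply: (hull_mono _ (hull_scale _ (hull_pow jN cs))); rewrite ?exprn_ge0 //.
by rewrite mulr1 exprn_ile1.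
Qed.

Lemma hull_Xgeom_sum n : (n <= N)%N -> hull N (fun x => x%:C * geom_sum c s n x) n%:R.
Proof.
move=> nN; have -> : n%:R = \sum_(j < n) 1 :> R by rewrite sumr_const card_ord.
apply: (@hull_ext _ (fun x => \sum_(j < n) (c ^+ (n.-1 - j))%:C * (x%:C * Complex c (s * x) ^+ j))).
  by move=> x; rewrite mulr_sumr; apply: eq_bigr => j _; rewrite mulrCA.
apply: hull_sum => j _; have jN : (j < N)%N by rewrite (leq_trans _ nN).
apply: (hull_mono _ (hull_scale _ (hull_Xpow jN cs))); rewrite ?exprn_ge0 //.
by rewrite mulr1 exprn_ile1.
Qed.

(** This weight is the better one while |s| n <= 2; beyond that [hull_pow_diff2] bounds the two
    powers separately. *)
Lemma hull_pow_diff n : (n <= N)%N ->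
  hull N (fun x => (c ^+ n)%:C - Complex c (s * x) ^+ n) (`|s| * n%:R).
Proof.
move=> nN; apply: hull_ext (hull_opp (hull_scaleR s (hull_i (hull_Xgeom_sum nN)))) => x.
by rewrite geom_sum_diff.
Qed.

Lemma hull_pow_diff2 n : (n <= N)%N ->
  hull N (fun x => (c ^+ n)%:C - Complex c (s * x) ^+ n) 2.
Proof.
move=> nN; have u1 : (1 : R) ^+ 2 + 0 ^+ 2 = 1 by rewrite expr1n expr0n addr0.
have h1 := hull_scale (exprn_ge0 n c0) (hull_pow (leq0n N) u1).
have h2 := hull_add h1 (hull_opp (hull_pow nN cs)).
apply: (@hull_ext _ (fun x => (c ^+ n)%:C * Complex 1 (0 * x) ^+ 0 - Complex c (s * x) ^+ n)).
  by move=> x; rewrite expr0 mulr1.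
by apply: hull_mono h2; have := exprn_ile1 n c0 c1; lra.
Qed.

Definition sqrt_diff x : Cplx := sqrt_trunc N (Complex c (s * x)) - sqrt_trunc N (Complex c 0).

(** The quotient of [sqrt_diff] by x, written as a polynomial so that it also makes sense at x =
    0. *)
Definition sqrt_quot x : Cplx := \sum_(n < N) (- sqrt_coef n.+1 * - s)%:C * (Complex 0 1 * geom_sum c s n.+1 x).

Lemma sqrt_diffE x : sqrt_diff x = \sum_(n < N) (- sqrt_coef n.+1)%:C * ((c ^+ n.+1)%:C - Complex c (s * x) ^+ n.+1).
Proof.
rewrite /sqrt_diff /sqrt_trunc !big_ord_recl /= !expr0 opprD addrACA subrr add0r -sumrB.
apply: eq_bigr => i _; rewrite /bump /= add1n rmorphN -[Complex c 0]/(c%:C) rmorphXn.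
ring.
Qed.

Lemma sqrt_diff_quot x : sqrt_diff x = x%:C * sqrt_quot x.
Proof.
rewrite sqrt_diffE mulr_sumr; apply: eq_bigr => i _.
rewrite geom_sum_diff rmorphM (rmorphN _ s); ring.
Qed.

(** The n-th term costs |s| n |a_n| = |s| [cbinom] (n - 1) / 2, and [sum_cbinom] adds these up. *)
Lemma hull_sqrt_quot : hull N sqrt_quot (`|s| * N%:R * cbinom N).
Proof.
have -> : `|s| * N%:R * cbinom N = \sum_(n < N) (- sqrt_coef n.+1 * `|s|) * n.+1%:R.
  rewrite -mulrA [N%:R * _](_ : _ = 2^-1 * (2 * N%:R * cbinom N)); last by field.
  rewrite -sum_cbinom !mulr_sumr; apply: eq_bigr => i _.
  by rewrite mulrAC [_ * _%:R]mulrC sqrt_coef_mul; field.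
apply: hull_sum => n _.
have := hull_scaleR (- sqrt_coef n.+1 * - s) (hull_i (hull_geom_sum (leqW (ltn_ord n)))).
by rewrite normrM (normrN s) ger0_norm // oppr_ge0 sqrt_coef_le0.
Qed.

(* The first [L] terms are charged [|s| (n + 1)] each and the others [2]; [L] ~ 1/s balances the two. *)
Lemma hull_sqrt_diff L : (L <= N)%N -> hull N sqrt_diff ((`|s| * L%:R + 2) * cbinom L).
Proof.
move=> LN.
pose w (n : nat) : R := (- sqrt_coef n.+1 * (if (n < L)%N then `|s| * n.+1%:R else 2)).
(* The coefficients are differences of consecutive [cbinom], so the weight of the tail
   telescopes. *)
have tele : \sum_(L <= n < N) - sqrt_coef n.+1 = cbinom L - cbinom N.
  transitivity (\sum_(L <= n < N) (- cbinom n.+1 - - cbinom n)).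
    by apply: eq_bigr => i _; rewrite /sqrt_coef opprB opprK addrC.
  by rewrite (telescope_sumr (fun n => - cbinom n) LN) opprK addrC.
have W : \sum_(n < N) w n <= (`|s| * L%:R + 2) * cbinom L.
  rewrite -(big_mkord xpredT w) (@big_cat_nat _ _ _ L) //=.
  rewrite [X in X + _](_ : _ = `|s| * L%:R * cbinom L); last first.
    rewrite big_mkord -mulrA [L%:R * _](_ : _ = 2^-1 * (2 * L%:R * cbinom L)); last by field.
    rewrite -sum_cbinom !mulr_sumr; apply: eq_bigr => i _.
    rewrite /w ltn_ord mulrCA; by congr (_ * _); rewrite mulrC sqrt_coef_mul; field.
  rewrite [X in _ + X](_ : _ = 2 * (cbinom L - cbinom N)); last first.
    rewrite -tele mulr_sumr; apply: eq_big_nat => i /andP[Li _].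
    by rewrite /w ltnNge Li mulrC.
  have := cbinom_gt0 N; move: (cbinom L) (cbinom N) (L%:R : R) `|s| => p q l t q0; lra.
apply: hull_mono W _.
apply: (@hull_ext _ (fun x => \sum_(n < N) (- sqrt_coef n.+1)%:C * ((c ^+ n.+1)%:C - Complex c (s * x) ^+ n.+1))).
  by move=> x; rewrite sqrt_diffE.
apply: hull_sum => n _; apply: hull_scale; first by rewrite oppr_ge0 sqrt_coef_le0.
by case: ifP => _; [apply: hull_pow_diff | apply: hull_pow_diff2].
Qed.

End Cost.

Lemma sqrt_trunc_conj N z : (sqrt_trunc N z)^*%C = sqrt_trunc N z^*%C.
Proof.
rewrite /sqrt_trunc rmorph_sum; apply: eq_bigr => i _.
by rewrite rmorphM rmorphXn /=; congr (_ * _); rewrite oppr0.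
Qed.

(** The series has real coefficients, so replacing s by -s conjugates its value, and the real part
    is half the sum of the two. Both come from unitary factors. *)
Lemma sqrt_approxE N c s x : (sqrt_approx c s N x)%:C =
  (Num.sqrt (2 / s) / 2)%:C * (sqrt_diff N c s x + sqrt_diff N c (- s) x).
Proof.
have re (z : Cplx) : z + z^*%C = 2%:C * (complex.Re z)%:C.
  by rewrite addcJ -[2%:R](rmorph_nat (real_complex R)).
have -> : sqrt_diff N c (- s) x = (sqrt_diff N c s x)^*%C.
  rewrite /sqrt_diff rmorphB /= !sqrt_trunc_conj /= oppr0.
  by congr (sqrt_trunc _ (Complex _ _) - _); ring.
rewrite re mulrA -rmorphM /= -rmorphM; congr (_ %:C).
by rewrite /sqrt_approx /sqrt_diff ReB; field.
Qed.

Section ApproxCost.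
Variables (K : nat) (c s : R).
Hypotheses (cs : c ^+ 2 + s ^+ 2 = 1) (c0 : 0 <= c) (s0 : 0 < s) (sK : s * K%:R = 1).
Let N := (K ^ 2)%N.

Let cs' : c ^+ 2 + (- s) ^+ 2 = 1.
Proof. by rewrite sqrrN. Qed.

Let cbinom_sqrt (n : nat) : n%:R * (cbinom n) ^+ 2 <= 2^-1.
Proof. by have := cbinom_sqr n; have := sqr_ge0 (cbinom n); lra. Qed.

(** Taking L = K gives s L = 1, hence the total 3 √(2/s) [cbinom K], and 2 K ([cbinom K])^2 <= 1. *)
Lemma hull_sqrt_approx : hull N (fun x => (sqrt_approx c s N x)%:C) 3.
Proof.
have K0 : (0 < K)%N by case: K sK => //; rewrite mulr0 => /esym/eqP; rewrite oner_eq0.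
have KN : (K <= N)%N by rewrite /N -mulnn leq_pmull.
have l0 : 0 <= Num.sqrt (2 / s) / 2 by rewrite divr_ge0 ?sqrtr_ge0.
have h := hull_scale l0 (hull_add (hull_sqrt_diff cs c0 KN) (hull_sqrt_diff cs' c0 KN)).
apply: (hull_ext _ (hull_mono _ h)); first by move=> x; rewrite sqrt_approxE.
rewrite normrN gtr0_norm // sK.
have {h} : Num.sqrt (2 / s) * cbinom K <= 1.
  apply: le_of_sqr => //; rewrite expr1n exprMn sqr_sqrtr ?divr_ge0 ?(ltW s0) //.
  have := cbinom_sqrt K; have -> : 2 / s = 2 * K%:R.
    by congr (_ * _); apply: (mulfI (lt0r_neq0 s0)); rewrite sK divff ?lt0r_neq0.
  lra.
lra.
Qed.

(** This version is applied to the state whose factor x the measured trace already contains. Without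
    the splitting of the sum its weight grows like √K. *)
Lemma hull_sqrt_approx_quot : exists2 f, hull N f (Num.sqrt s^-1) &
  forall x, (sqrt_approx c s N x)%:C = x%:C * f x.
Proof.
have l0 : 0 <= Num.sqrt (2 / s) / 2 by rewrite divr_ge0 ?sqrtr_ge0.
have h := hull_scale l0 (hull_add (hull_sqrt_quot N cs c0) (hull_sqrt_quot N cs' c0)).
eexists; last by move=> x; rewrite sqrt_approxE !sqrt_diff_quot -mulrDr mulrCA.
apply: hull_mono h; rewrite normrN gtr0_norm //.
have si0 : 0 <= s^-1 by rewrite invr_ge0 ltW.
rewrite [X in X <= _](_ : _ = Num.sqrt (2 / s) * (s * N%:R * cbinom N)); last by field.
apply: le_of_sqr; first exact: sqrtr_ge0.
rewrite exprMn !sqr_sqrtr ?divr_ge0 ?(ltW s0) //.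
have sN : s ^+ 2 * N%:R = 1 by rewrite /N natrX -exprMn sK expr1n.
have := cbinom_sqrt N; set b := cbinom N => hb.
have -> : 2 / s * (s * N%:R * b) ^+ 2 = s^-1 * (s ^+ 2 * N%:R) * (2 * (N%:R * b ^+ 2)).
  by field; rewrite gt_eqF.
by rewrite sN mulr1 ler_piMr //; lra.
Qed.

End ApproxCost.
(** * Effects and observables on copies of the states *)

Lemma sum_pair (I J : finType) (f : I * J -> Cplx) : \sum_p f p = \sum_i \sum_j f (i, j).
Proof. by rewrite pair_bigA; apply: eq_bigr => -[]. Qed.

Section Gram.
Implicit Types I J K : finType.

(** Operators are kernels over arbitrary finite types rather than matrices; tensor products are then
    plain pairs and need no index arithmetic. [kron] is the identity operator. *)
Definition kron I (i j : I) : Cplx := (i == j)%:R.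

(* Positivity by a Gram decomposition, which makes closure under tensor products immediate. *)
Definition gram I (E : I -> I -> Cplx) : Prop :=
  exists (K : finType) (B : K -> I -> Cplx), forall i j, E i j = \sum_k (B k i)^* * B k j.

Definition ktrace I (E S : I -> I -> Cplx) : Cplx := \sum_i \sum_j E i j * S j i.

Lemma kron_conj I (i j : I) : (kron i j)^* = kron j i.
Proof. by rewrite /kron rmorph_nat eq_sym. Qed.

Lemma kronC I (i j : I) : kron i j = kron j i.
Proof. by rewrite /kron eq_sym. Qed.

Lemma sum_kronl I (i : I) (f : I -> Cplx) : \sum_k kron k i * f k = f i.
Proof.
rewrite (bigD1 i) //= /kron eqxx mul1r big1 ?addr0 // => k /negbTE ->.
by rewrite mul0r.
Qed.

Lemma sum_kronr I (i : I) (f : I -> Cplx) : \sum_k f k * kron k i = f i.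
Proof. by rewrite -[RHS](sum_kronl i f); apply: eq_bigr => k _; rewrite mulrC. Qed.

Lemma eq_gram I (E E' : I -> I -> Cplx) : (forall i j, E i j = E' i j) -> gram E -> gram E'.
Proof. by move=> e [K [B h]]; exists K, B => i j; rewrite -e. Qed.

Lemma gram_kron I : gram (@kron I).
Proof.
exists I, (fun k i => kron k i) => i j; rewrite -[LHS](sum_kronl i (fun k => kron k j)).
by apply: eq_bigr => k _; rewrite kron_conj /kron eq_sym.
Qed.

Lemma gram_add I (E F : I -> I -> Cplx) : gram E -> gram F -> gram (fun i j => E i j + F i j).
Proof.
move=> [K [B hB]] [L [C hC]].
exists (K + L)%type, (fun k i => match k with inl k => B k i | inr l => C l i end) => i j.
by rewrite big_sumType /= hB hC.
Qed.

Lemma gram_scale I (t : R) (E : I -> I -> Cplx) : 0 <= t -> gram E -> gram (fun i j => t%:C * E i j).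
Proof.
move=> t0 [K [B hB]]; exists K, (fun k i => (Num.sqrt t)%:C * B k i) => i j.
rewrite hB mulr_sumr; apply: eq_bigr => k _; rewrite rmorphM mulrACA; congr (_ * _).
by rewrite -[X in _ = X * _]/((Num.sqrt t)%:C^*%C) conjc_real -rmorphM /= -expr2 sqr_sqrtr.
Qed.

Lemma gram_tens I J (E : I -> I -> Cplx) (F : J -> J -> Cplx) :
  gram E -> gram F -> gram (fun x y : I * J => E x.1 y.1 * F x.2 y.2).
Proof.
move=> [K [B hB]] [L [C hC]].
exists (K * L)%type, (fun k x => B k.1 x.1 * C k.2 x.2) => x y.
rewrite hB hC mulr_suml sum_pair /=.
apply: eq_bigr => k _; rewrite mulr_sumr; apply: eq_bigr => l _.
by rewrite rmorphM mulrACA.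
Qed.

Lemma gram_pull I J (h : J -> I) (E : I -> I -> Cplx) : gram E -> gram (fun x y => E (h x) (h y)).
Proof. by move=> [K [B hB]]; exists K, (fun k x => B k (h x)) => x y; rewrite hB. Qed.

Lemma ktrace_add I (E F S : I -> I -> Cplx) : ktrace (fun i j => E i j + F i j) S = ktrace E S + ktrace F S.
Proof.
rewrite /ktrace -big_split; apply: eq_bigr => i _; rewrite -big_split.
by apply: eq_bigr => j _; rewrite mulrDl.
Qed.

Lemma ktrace_scale I (t : Cplx) (E S : I -> I -> Cplx) : ktrace (fun i j => t * E i j) S = t * ktrace E S.
Proof.
rewrite /ktrace mulr_sumr; apply: eq_bigr => i _; rewrite mulr_sumr.
by apply: eq_bigr => j _; rewrite mulrA.
Qed.

Lemma eq_ktrace I (E F S : I -> I -> Cplx) : (forall i j, E i j = F i j) -> ktrace E S = ktrace F S.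
Proof. by move=> e; apply: eq_bigr => i _; apply: eq_bigr => j _; rewrite e. Qed.

Lemma ktrace_tens I J (E S : I -> I -> Cplx) (F T : J -> J -> Cplx) :
  ktrace (fun x y : I * J => E x.1 y.1 * F x.2 y.2) (fun x y => S x.1 y.1 * T x.2 y.2)
  = ktrace E S * ktrace F T.
Proof.
rewrite /ktrace mulr_suml.
rewrite sum_pair /=.
apply: eq_bigr => i _.
rewrite mulr_sumr; apply: eq_bigr => j _; rewrite mulr_suml.
rewrite sum_pair /=.
apply: eq_bigr => i' _; rewrite mulr_sumr; apply: eq_bigr => j' _.
by rewrite mulrACA.
Qed.

Lemma ktrace_kron I (S : I -> I -> Cplx) : ktrace (@kron I) S = \sum_i S i i.
Proof.
apply: eq_bigr => i _; rewrite -[RHS](sum_kronl i (fun j => S j i)).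
by apply: eq_bigr => j _; rewrite /kron eq_sym.
Qed.

End Gram.

(** * Registers, observables and dilations *)

Section Spaces.
Variable d : nat.
Local Notation M := 'M[Cplx]_d.

(** A register with its state as a function of both inputs, so that one measurement can be chosen
    independently of the unknown states. *)
Record space := Space { carrier :> finType; st : M -> M -> carrier -> carrier -> Cplx }.

Definition point : space := @Space unit (fun _ _ _ _ => 1).

Definition prods (I J : space) : space :=
  @Space (I * J)%type (fun r s x y => st r s x.1 y.1 * st r s x.2 y.2).

Definition single (b : bool) : space := @Space 'I_d (fun r s i j => (if b then r else s) i j).

Definition copy b J := prods (single b) J.

Definition state_space (I : space) : Prop := forall r s, density r -> density s ->
  \sum_(i : I) st r s i i = 1 /\ forall i j : I, (st r s i j)^* = st r s j i.

Lemma state_space_point : state_space point.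
Proof.
move=> r s _ _; split=> [|i j]; last by rewrite rmorph1.
by rewrite big_const /= card_unit /= addr0.
Qed.

(** Polarization: the order on [Cplx] forces the quadratic form to be real, and its values at e_i,
    e_j, e_i + e_j and e_i + i e_j determine the claim. *)
Lemma psd_herm n (A : 'M[Cplx]_n) : psd A -> forall i j, (A i j)^* = A j i.
Proof.
move=> h i j.
pose q (z w : Cplx) := z^* * A i i * z + z^* * A i j * w + w^* * A j i * z + w^* * A j j * w.
have qr (z w : Cplx) : (q z w)^* = q z w.
  pose v : 'cV[Cplx]_n := z *: delta_mx i 0 + w *: delta_mx j 0.
  have := h v; have -> : (adj v *m A *m v) 0 0 = q z w.
    rewrite /v /adj map_mxD linearD /= !map_mxZ !linearZ /= !map_delta_mx /=.
    rewrite [(_ + _)^T]linearD /= ![(_ *: _)^T]linearZ /= !trmx_delta.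
    rewrite !mulmxDl -!scalemxAl.
    rewrite -!rowE -!colE !mxE /q; ring.
  by move=> /ger0_real/CrealP.
have h1 := qr (Complex 1 0) (Complex 0 0); have h2 := qr (Complex 0 0) (Complex 1 0).
have h3 := qr (Complex 1 0) (Complex 1 0); have h4 := qr (Complex 1 0) (Complex 0 1).
have J (z : Cplx) : z^* = z^*%C by [].
move: h1 h2 h3 h4; rewrite /q !J.
case: (A i i) => a a'; case: (A i j) => b b'; case: (A j i) => c c'; case: (A j j) => e e'.
move=> /(congr1 (@complex.Im _)) /= i1 /(congr1 (@complex.Im _)) /= i2.
by move=> /(congr1 (@complex.Im _)) /= i3 /(congr1 (@complex.Im _)) /= i4; congr Complex; lra.
Qed.

Lemma state_space_copy b J : state_space J -> state_space (copy b J).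
Proof.
move=> gJ r s dr ds; have [tJ hJ] := gJ r s dr ds.
have dt : density (if b then r else s) by case: b.
rewrite /=; move: (if b then r else s) dt => t [pt tt]; split=> /=; last first.
  by move=> x y; rewrite rmorphM /= hJ psd_herm.
rewrite sum_pair /=.
rewrite -[RHS]mulr1 -{1}tt -tJ mulr_suml; apply: eq_bigr => i _.
by rewrite mulr_sumr.
Qed.

Definition unitary_kernel (I : finType) (W : I -> I -> Cplx) : Prop :=
  forall i j, \sum_k (W k i)^* * W k j = kron i j.

(* For every phase [e], (m + Re (e F)) / (2 m) is the probability of an outcome of a measurement
   on [I]. *)
Definition observable (I : space) (F : M -> M -> Cplx) (m : R) : Prop :=
  forall e : Cplx, `|e| = 1 -> exists E1 E2 : I -> I -> Cplx,
  [/\ gram E1, gram E2, forall i j, E1 i j + E2 i j = m%:C * kron i j &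
   forall r s, density r -> density s ->
     ktrace E1 (st r s) = ((m + complex.Re (e * F r s)) / 2)%:C].

Lemma observable_add I F F' m m' : observable I F m -> observable I F' m' -> observable I (fun r s => F r s + F' r s) (m + m').
Proof.
move=> h h' e e1; have [E1 [E2 [g1 g2 E12 tE]]] := h e e1.
have [E1' [E2' [g1' g2' E12' tE']]] := h' e e1.
eexists _, _; split; [exact: gram_add g1 g1' | exact: gram_add g2 g2' | |].
  by move=> i j; rewrite addrACA E12 E12' rmorphD mulrDl.
move=> r s dr ds; rewrite ktrace_add tE // tE' // -rmorphD /= mulrDr ReD.
by congr (_ %:C); field.
Qed.

Lemma observable_scale I F m (t : R) : 0 <= t -> observable I F m -> observable I (fun r s => t%:C * F r s) (t * m).
Proof.
move=> t0 h e e1; have [E1 [E2 [g1 g2 E12 tE]]] := h e e1.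
eexists _, _; split; [exact: gram_scale t0 g1 | exact: gram_scale t0 g2 | |].
  by move=> i j; rewrite -mulrDr E12 rmorphM mulrA.
move=> r s dr ds; rewrite ktrace_scale tE // mulrCA ReZ -rmorphM /=.
by congr (_ %:C); field.
Qed.

(** The factor i is absorbed in the phase, which is why [observable] quantifies over all phases. *)
Lemma observable_i I F m : observable I F m -> observable I (fun r s => Complex 0 1 * F r s) m.
Proof.
move=> h e e1; have ie : `|e * Complex 0 1| = 1.
  by rewrite normrM e1 mul1r normc_def /= expr0n expr1n add0r sqrtr1.
have [E1 [E2 [g1 g2 E12 tE]]] := h _ ie.
by exists E1, E2; split=> // r s dr ds; rewrite tE // mulrA.
Qed.

Lemma observable_ext I F F' m : (forall r s, density r -> density s -> F r s = F' r s) ->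
  observable I F m -> observable I F' m.
Proof.
move=> eF h e e1; have [E1 [E2 [g1 g2 E12 tE]]] := h e e1.
by exists E1, E2; split=> // r s dr ds; rewrite tE // eF.
Qed.

Lemma observable_unitary (I : space) (W : I -> I -> Cplx) : state_space I -> unitary_kernel W ->
  observable I (fun r s => ktrace W (st r s)) 1.
Proof.
move=> gI uW e e1.
have ee : e^* * e = 1 by rewrite mulrC -normCK e1 expr1n.
(* The kernel is (1 + uW)^*(1 + uW) / 4, which gives its Gram form. *)
have G (u : Cplx) : u^* * u = 1 -> gram (fun i j =>
    4^-1 * (kron i j + kron i j + (u * W i j + (u * W j i)^*))).
  move=> uu; exists I, (fun k i => 2^-1 * (kron k i + u * W k i)) => i j.
  transitivity (4^-1 * \sum_k (kron k i * kron k j + (kron k i * (u * W k j)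
      + ((u * W k i)^* * kron k j + (u^* * u) * ((W k i)^* * W k j))))).
    rewrite !big_split /= -mulr_sumr uW uu mul1r.
    rewrite (sum_kronl i (fun k => kron k j)) (sum_kronl i (fun k => u * W k j)).
    rewrite (sum_kronr j (fun k => (u * W k i)^*)); congr (_ * _); ring.
  rewrite mulr_sumr; apply: eq_bigr => k _.
  have h2 : (2^-1 : Cplx)^* = 2^-1 by rewrite fmorphV rmorph_nat.
  rewrite [X in _ = X * _]rmorphM /= h2 [X in _ = _ * X * _]rmorphD /= kron_conj (kronC i k).
  by rewrite rmorphM /=; field.
(* The complementary outcome uses the opposite phase -e, so that the terms in W cancel in the
   sum. *)
exists (fun i j => 4^-1 * (kron i j + kron i j + (e * W i j + (e * W j i)^*))),
  (fun i j => 4^-1 * (kron i j + kron i j + ((- e) * W i j + ((- e) * W j i)^*))).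
split; [exact: G | by apply: G; rewrite rmorphN mulrNN | |].
  by move=> i j; rewrite !mulNr rmorphN /= mul1r; field.
move=> r s dr ds; have [tI hI] := gI r s dr ds.
rewrite ktrace_scale !ktrace_add ktrace_kron tI ktrace_scale.
have -> : ktrace (fun i j => (e * W j i)^*) (st r s) = (e * ktrace W (st r s))^*.
  rewrite -ktrace_scale /ktrace exchange_big rmorph_sum; apply: eq_bigr => i _.
  rewrite rmorph_sum; apply: eq_bigr => j _ /=.
  by rewrite [RHS]rmorphM /= hI.
have -> : e * ktrace W (st r s) + (e * ktrace W (st r s))^* =
    2 * (complex.Re (e * ktrace W (st r s)))%:C by rewrite -addcJ.
by rewrite rmorphM rmorphD fmorphV rmorph_nat rmorph1; field.
Qed.

(* [W] acts on one register and [J]; its partial trace against the state of [J] is [P]. *)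
Definition dilation (J : space) (P : M -> M -> M) : Prop :=
  exists2 W : 'I_d * J -> 'I_d * J -> Cplx, unitary_kernel W &
  forall r s, density r -> density s -> forall i i',
    \sum_x \sum_x' W (i, x) (i', x') * st r s x' x = P r s i i'.

Lemma dilation_ext J P P' : (forall r s, density r -> density s -> P r s = P' r s) ->
  dilation J P -> dilation J P'.
Proof. by move=> e [W uW h]; exists W => // r s dr ds i i'; rewrite h // e. Qed.

Lemma dilation_point : dilation point (fun _ _ => 1%:M).
Proof.
exists (@kron _) => [i j|r s _ _ i i'].
  rewrite -[RHS](sum_kronl i (fun k => kron k j)).
  by apply: eq_bigr => k _; rewrite kron_conj /kron eq_sym.
rewrite !(big_pred1 tt) => [|[]|[]] //.
by rewrite mulr1 mxE /kron xpair_eqE andbT.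
Qed.

(** A copy of the first state fed into the system register turns the partial trace P into tr(ρ
    P). *)
Lemma dilation_final J P : state_space J -> dilation J P -> observable (copy true J) (fun r s => \tr (r *m P r s)) 1.
Proof.
move=> gJ [W uW h]; apply: observable_ext (observable_unitary (state_space_copy true gJ) uW) => r s dr ds.
rewrite /ktrace sum_pair /=.
rewrite mxtrace_mulC; apply: eq_bigr => i _; rewrite mxE.
rewrite (eq_bigr (fun x => \sum_i' \sum_x' W (i, x) (i', x') * (r i' i * st r s x' x))); last first.
  by move=> x _; rewrite sum_pair.
rewrite exchange_big; apply: eq_bigr => i' _; rewrite -h // mulr_suml.
apply: eq_bigr => x _; rewrite mulr_suml; apply: eq_bigr => x' _ /=.
by rewrite mulrCA mulrA mulrC mulrA [W _ _ * _]mulrC mulrAC.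
Qed.


(* The new unitary is (c + it S)(1 ⊗ W), with S swapping the system register and the fresh copy, and
   W acting on the system and on [J]. *)
Lemma dilation_step b J P (c t : R) : state_space J -> c ^+ 2 + t ^+ 2 = 1 -> dilation J P ->
  dilation (copy b J) (fun r s => ((c%:C)%:M + Complex 0 t *: (if b then r else s)) *m P r s).
Proof.
move=> gJ ct [W uW hW].
set u : Cplx := c%:C; set v : Cplx := Complex 0 t.
have uv1 : u^* * u + v^* * v = 1.
  rewrite -[u^*]/(u^*%C) -[v^*]/(v^*%C) /u /v; apply/eqP; rewrite eq_complex /=.
  by apply/andP; split; apply/eqP; [rewrite -ct; ring | ring].
have uv0 : u^* * v + v^* * u = 0.
  rewrite -[u^*]/(u^*%C) -[v^*]/(v^*%C) /u /v; apply/eqP; rewrite eq_complex /=.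
  by apply/andP; split; apply/eqP; ring.
pose W' (p q : 'I_d * ('I_d * J)) : Cplx :=
  u * (kron p.2.1 q.2.1 * W (p.1, p.2.2) (q.1, q.2.2))
  + v * (kron p.1 q.2.1 * W (p.2.1, p.2.2) (q.1, q.2.2)).
exists W'.
  move=> [i1 [j1 x1]] [i2 [j2 x2]]; rewrite sum_pair.
  pose h i j : Cplx := \sum_x (W (i, x) (i1, x1))^* * W (j, x) (i2, x2).
  have hS : \sum_i h i i = kron (i1, x1) (i2, x2) by rewrite -uW sum_pair.
  transitivity (\sum_i \sum_j
     (u^* * u * (kron j j1 * (kron j j2 * h i i)) + u^* * v * (kron j j1 * (kron i j2 * h i j))
     + (v^* * u * (kron i j1 * (kron j j2 * h j i)) + v^* * v * (kron i j1 * (kron i j2 * h j j))))).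
    apply: eq_bigr => i _; rewrite sum_pair; apply: eq_bigr => j _.
    rewrite /h !mulr_sumr -!big_split; apply: eq_bigr => x _ /=.
    by rewrite /W' /= !(rmorphD, rmorphM) /= !kron_conj [kron j1 j]kronC [kron j1 i]kronC; ring.
  rewrite (eq_bigr (fun i => u^* * u * (kron j1 j2 * h i i) + u^* * v * (kron i j2 * h i j1)
     + (v^* * u * (kron i j1 * h j2 i) + v^* * v * (kron i j1 * (kron i j2 * kron (i1, x1) (i2, x2)))))); last first.
    move=> i _; rewrite !big_split /= -!mulr_sumr -hS.
    rewrite (sum_kronl j1 (fun j => kron j j2 * h i i)) (sum_kronl j1 (fun j => kron i j2 * h i j)).
    by rewrite (sum_kronl j2 (fun j => h j i)).
  rewrite !big_split /= -!mulr_sumr hS (sum_kronl j2 (fun i => h i j1)) (sum_kronl j1 (fun i => h j2 i)).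
  rewrite (sum_kronl j1 (fun i => kron i j2 * kron (i1, x1) (i2, x2))).
  (* Both mixed terms collapse to the same [h j2 j1], and their coefficients cancel because u is
     real and v imaginary. *)
  transitivity ((u^* * u + v^* * v) * (kron j1 j2 * kron (i1, x1) (i2, x2)) + (u^* * v + v^* * u) * h j2 j1).
    by ring.
  rewrite uv1 uv0 mul0r addr0 mul1r /kron !xpair_eqE -natrM.
  by congr (_%:R); case: (i1 == i2); case: (j1 == j2); case: (x1 == x2).
move=> r s dr ds i i'; rewrite /=.
have trt : \tr (if b then r else s) = 1 by case: b; case: dr; case: ds.
move: (if b then r else s) trt => T trt.
rewrite sum_pair.
(* In the identity term the fresh copy T is traced out to 1; in the swap term it multiplies P from
   the left. *)
rewrite (eq_bigr (fun j => u * (T j j * P r s i i') + v * (T i j * P r s j i'))); last first.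
  move=> j _; rewrite -!hW // !mulr_sumr -big_split; apply: eq_bigr => x _ /=.
  rewrite sum_pair.
  transitivity (\sum_(j' : 'I_d) (u * (kron j j' * (T j' j * \sum_x' W (i, x) (i', x') * st r s x' x))
     + v * (kron i j' * (T j' j * \sum_x' W (j, x) (i', x') * st r s x' x)))).
    apply: eq_bigr => j' _; rewrite !mulr_sumr -big_split; apply: eq_bigr => x' _ /=.
    by rewrite /W' /=; ring.
  rewrite big_split /= -!mulr_sumr.
  rewrite (eq_bigr (fun j' => kron j' j * (T j' j * \sum_x' W (i, x) (i', x') * st r s x' x))); last first.
    by move=> j' _; rewrite kronC.
  rewrite (sum_kronl j (fun j' => T j' j * _)).
  rewrite (eq_bigr (fun j' => kron j' i * (T j' j * \sum_x' W (j, x) (i', x') * st r s x' x))); last first.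
    by move=> j' _; rewrite kronC.
  by rewrite (sum_kronl i (fun j' => T j' j * _)).
rewrite big_split /= -!mulr_sumr -mulr_suml -/(\tr T) trt mul1r.
by rewrite mulmxDl mul_scalar_mx -scalemxAl !mxE.
Qed.

Definition copies b n J := iter n (copy b) J.

Lemma state_space_copies b n J : state_space J -> state_space (copies b n J).
Proof. by move=> gJ; elim: n => //= n IH; apply: state_space_copy. Qed.

Definition mprod (cs : seq (R * R)) (T : M) : M :=
  foldr (fun t X => ((t.1%:C)%:M + Complex 0 t.2 *: T) *m X) 1%:M cs.

Lemma dilation_copies b J P cs : state_space J -> unitary_coefs cs -> dilation J P ->
  dilation (copies b (size cs) J) (fun r s => mprod cs (if b then r else s) *m P r s).
Proof.
move=> gJ + cP; elim: cs => [_|[c t] cs IH /= /andP[/eqP /= ct /IH IH']].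
  by apply: dilation_ext cP => r s _ _; rewrite mul1mx.
by apply: dilation_ext (dilation_step b (state_space_copies b _ gJ) ct IH') => r s _ _; rewrite mulmxA.
Qed.

(* The copy in front is the state that the dilation acts on; it supplies the factor [r] in
   [\tr (r *m _)]. *)
Definition probe n : space := copy true (copies true n (copies false n point)).

Lemma observable_mprod n cs cs' : unitary_coefs cs -> unitary_coefs cs' -> size cs = n -> size cs' = n ->
  observable (probe n) (fun r s => \tr (r *m (mprod cs r *m mprod cs' s))) 1.
Proof.
move=> u u' <- e; rewrite /probe -{2}e.
have g' := state_space_copies false (size cs') state_space_point.
apply: observable_ext (dilation_final (state_space_copies true _ g')
   (dilation_copies true g' u (dilation_copies false state_space_point u' dilation_point))) => r s _ _.
by rewrite mulmx1.
Qed.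

End Spaces.
(** * Spectral form of the affinity *)

Lemma conjmx_mul (F : fieldType) n (P A B : 'M[F]_n) : P \in unitmx ->
  (invmx P *m A *m P) *m (invmx P *m B *m P) = invmx P *m (A *m B) *m P.
Proof. by move=> uP; rewrite !mulmxA mulmxK. Qed.

Lemma tr_conjmx (F : fieldType) n (P A : 'M[F]_n) : P \in unitmx ->
  \tr (invmx P *m A *m P) = \tr A.
Proof. by move=> uP; rewrite mxtrace_mulC mulmxA mulmxV // mul1mx. Qed.

Lemma tr_conjmx2 (F : fieldType) n (P Q A B : 'M[F]_n) :
  \tr ((invmx P *m A *m P) *m (invmx Q *m B *m Q)) =
  \tr (A *m (P *m invmx Q) *m (B *m (Q *m invmx P))).
Proof. by rewrite -!mulmxA mxtrace_mulC -!mulmxA. Qed.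

Lemma tr_sqr_diff (F : comNzRingType) n (A B : 'M[F]_n) :
  \tr ((A - B) *m (A - B)) = \tr (A *m A) - 2 * \tr (A *m B) + \tr (B *m B).
Proof.
rewrite mulmxBl !mulmxBr !linearB /= [\tr (B *m A)]mxtrace_mulC opprB addrA mulr_natl mulr2n.
by rewrite opprD addrA -!addrA [_ + \tr (B *m B)]addrC.
Qed.

Lemma adjE m n (A : 'M[Cplx]_(m, n)) : adj A = map_mx Num.conj A^T.
Proof. by rewrite /adj map_trmx. Qed.

Lemma adj_mul m n p (A : 'M[Cplx]_(m, n)) (B : 'M[Cplx]_(n, p)) :
  adj (A *m B) = adj B *m adj A.
Proof. by rewrite /adj map_mxM trmx_mul. Qed.

Lemma adjK m n (A : 'M[Cplx]_(m, n)) : adj (adj A) = A.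
Proof. by apply/matrixP => i j; rewrite !mxE conjCK. Qed.

Lemma invmx_adj n (P : 'M[Cplx]_n) : P \is unitarymx -> invmx P = adj P.
Proof. by move=> uP; rewrite adjE invmx_unitary. Qed.

Section Spectral.
Variable d : nat.
Implicit Types (P Q r s : 'M[Cplx]_d).

Definition dmx (x : 'I_d -> Cplx) : 'M[Cplx]_d := diag_mx (\row_k x k).

Lemma dmxE x i j : dmx x i j = x i *+ (i == j).
Proof. by rewrite !mxE; case: eqP => [->|]. Qed.

Definition diagconj P (x : 'I_d -> Cplx) : 'M[Cplx]_d := invmx P *m dmx x *m P.

Lemma eq_dmx x y : x =1 y -> dmx x = dmx y.
Proof. by move=> e; apply/matrixP => i j; rewrite !dmxE e. Qed.

Lemma eq_diagconj P x y : x =1 y -> diagconj P x = diagconj P y.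
Proof. by move=> e; rewrite /diagconj (eq_dmx e). Qed.

Lemma dmxM x y : dmx x *m dmx y = dmx (fun k => x k * y k).
Proof.
rewrite /dmx mulmx_diag; apply/matrixP => i j; rewrite !mxE.
by case: eqP => [->|].
Qed.

Lemma diagconjM P x y : P \in unitmx ->
  diagconj P x *m diagconj P y = diagconj P (fun k => x k * y k).
Proof. by move=> uP; rewrite /diagconj -dmxM; exact: conjmx_mul. Qed.

Lemma diagconjD P x y : diagconj P x + diagconj P y = diagconj P (fun k => x k + y k).
Proof.
rewrite /diagconj -mulmxDl -mulmxDr (_ : dmx x + dmx y = dmx (fun k => x k + y k)) //.
by apply/matrixP => i j; rewrite mxE !dmxE mulrnDl.
Qed.

Lemma diagconjZ P (a : Cplx) x : a *: diagconj P x = diagconj P (fun k => a * x k).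
Proof.
rewrite /diagconj scalemxAl scalemxAr (_ : a *: dmx x = dmx (fun k => a * x k)) //.
by apply/matrixP => i j; rewrite mxE !dmxE mulrnAr.
Qed.

Lemma diagconj_scalar P (a : Cplx) : P \in unitmx -> diagconj P (fun=> a) = a%:M.
Proof.
move=> uP; rewrite /diagconj (_ : dmx _ = a%:M); last by apply/matrixP => i j; rewrite dmxE mxE.
by rewrite mul_mx_scalar -scalemxAl mulVmx // scalemx1.
Qed.

Lemma tr_diagconj P x : P \in unitmx -> \tr (diagconj P x) = \sum_k x k.
Proof.
move=> uP; rewrite /diagconj tr_conjmx //.
by apply: eq_bigr => k _; rewrite dmxE eqxx.
Qed.

Lemma psd_diagconj P x : P \is unitarymx -> (forall k, 0 <= x k) -> psd (diagconj P x).
Proof.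
move=> uP x0 v; rewrite /diagconj invmx_adj // !mulmxA -(mulmxA _ P v) -adj_mul.
move: (P *m v) => u; rewrite mxE; apply: sumr_ge0 => k _.
rewrite mul_mx_diag !mxE mulrAC mulr_ge0 // mulrC.
by rewrite -normCK exprn_ge0.
Qed.

Lemma psd_spectral (A : 'M[Cplx]_d) : psd A ->
  A = diagconj (spectralmx A) (spectral_diag A 0) /\ forall k, 0 <= spectral_diag A 0 k.
Proof.
move=> pA; have hA : A \is hermsymmx.
  apply/is_hermitianmxP; rewrite expr0 scale1r; apply/matrixP => i j.
  by rewrite !mxE psd_herm.
have uP := spectral_unitarymx A; have uP' := spectral_unit A.
have eA : A = diagconj (spectralmx A) (spectral_diag A 0).
  rewrite {1}(orthomx_spectralP (hermitian_normalmx hA)) /diagconj.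
  rewrite (_ : dmx _ = diag_mx (spectral_diag A)) //.
  by apply/matrixP => i j; rewrite dmxE mxE.
(* The k-th eigenvector is used as test vector. *)
split=> // k; have := pA (invmx (spectralmx A) *m delta_mx k 0).
rewrite {2}eA; move: uP uP'; move: (spectralmx A) (spectral_diag A) => P x uP uP'.
rewrite adj_mul invmx_adj // adjK.
have -> : adj (delta_mx k 0 : 'cV[Cplx]_d) = delta_mx 0 k.
  by rewrite /adj map_delta_mx trmx_delta.
rewrite /diagconj -invmx_adj // !mulmxA mulmxK // mulmxK // -rowE.
rewrite mxE (bigD1 k) //= big1 => [|j /negbTE jk]; last by rewrite !mxE jk mulr0.
by rewrite !mxE !eqxx /= mulr1 mulr1n addr0.
Qed.

(** The choice in [psd_sqrt] has a witness: the square roots of the eigenvalues in the same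
    eigenbasis. *)
Lemma psd_sqrtP r : psd r -> psd (psd_sqrt r) /\ psd_sqrt r *m psd_sqrt r = r.
Proof.
move=> pr; rewrite /psd_sqrt; apply: (ClassicalEpsilon.epsilon_spec (inhabits 0) (fun B => psd B /\ B *m B = r)).
have [er x0] := psd_spectral pr; have uP := spectral_unitarymx r.
exists (diagconj (spectralmx r) (fun k => sqrtC (spectral_diag r 0 k))); split.
  by apply: psd_diagconj => // k; rewrite sqrtC_ge0.
rewrite (diagconjM _ _ (spectral_unit r)) [RHS]er; apply: eq_diagconj => k.
by rewrite -expr2 sqrtCK.
Qed.

(* Eigenvectors and eigenvalues are those of [psd_sqrt r], so uniqueness of the square root is never
   needed; the eigenvalues of [r] are the squares [eval r k ^+ 2]. *)
Definition evec r := spectralmx (psd_sqrt r).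
Definition eval r (k : 'I_d) : R := complex.Re (spectral_diag (psd_sqrt r) 0 k).

Lemma evec_unitary r : evec r \is unitarymx.
Proof. exact: spectral_unitarymx. Qed.

Lemma evec_unit r : evec r \in unitmx.
Proof. exact: spectral_unit. Qed.

Lemma sqrt_spectral r : psd r -> psd_sqrt r = diagconj (evec r) (fun k => (eval r k)%:C).
Proof.
move=> /psd_sqrtP[/psd_spectral[e x0] _]; rewrite {1}e; apply: eq_diagconj => k.
by rewrite /eval RRe_real // ger0_real.
Qed.

Lemma eval_ge0 r k : psd r -> 0 <= eval r k.
Proof.
move=> /psd_sqrtP[/psd_spectral[_ x0] _]; rewrite /eval.
by have := x0 k; rewrite lecE => /andP[_].
Qed.

Lemma spectral r : psd r -> r = diagconj (evec r) (fun k => (eval r k ^+ 2)%:C).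
Proof.
move=> pr; transitivity (diagconj (evec r) (fun k => (eval r k)%:C) *m diagconj (evec r) (fun k => (eval r k)%:C)).
  by rewrite -sqrt_spectral //; have [_ ->] := psd_sqrtP pr.
rewrite (diagconjM _ _ (evec_unit r)).
by apply: eq_diagconj => k; rewrite -rmorphM.
Qed.

Lemma sum_eval_sqr r : density r -> \sum_k eval r k ^+ 2 = 1.
Proof.
move=> [pr tr1]; move: tr1; rewrite {1}(spectral pr) tr_diagconj ?evec_unit //.
by rewrite -rmorph_sum => /complexI.
Qed.

Lemma eval_le1 r k : density r -> eval r k <= 1.
Proof.
move=> dr; have := sum_eval_sqr dr; rewrite (bigD1 k) //= => e.
apply: le_of_sqr => //; rewrite expr1n -e lerDl; apply: sumr_ge0 => j _; exact: sqr_ge0.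
Qed.

Lemma rank_diag_le (x : 'rV[Cplx]_d) : (\rank (diag_mx x) <= #|[pred k | x 0%R k != 0%R]|)%N.
Proof.
have -> : diag_mx x = \sum_(k | x 0 k != 0) x 0 k *: delta_mx k k.
  rewrite diag_mx_sum_delta (bigID (fun k => x 0 k != 0)) /= [X in _ + X]big1 ?addr0 //.
  by move=> k /negPn/eqP ->; rewrite scale0r.
rewrite -sum1_card; elim/big_ind2: _ => [|A m B n Am Bn|k _]; first by rewrite mxrank0.
  by apply: leq_trans (mxrank_add _ _) (leq_add _ _).
by apply: leq_trans (mxrank_scale _ _) _; rewrite mxrank_delta.
Qed.

(** Adding ones at the zero entries gives an invertible matrix, and the added matrix has rank at
    most the number of zeros. *)
Lemma rank_diag_ge (x : 'rV[Cplx]_d) : (#|[pred k | x 0%R k != 0%R]| <= \rank (diag_mx x))%N.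
Proof.
pose y : 'rV[Cplx]_d := \row_k (x 0 k == 0)%:R.
have r1 : \rank (diag_mx x + diag_mx y)%R = d.
  apply: mxrank_unit; have -> : diag_mx x + diag_mx y = diag_mx (x + y).
    by apply/matrixP => i j; rewrite !mxE mulrnDl.
  rewrite unitmxE det_diag unitfE; apply/prodf_neq0 => k _.
  by rewrite !mxE; have [->|h] := eqVneq (x 0 k) 0; rewrite ?add0r ?oner_eq0 ?addr0.
have := mxrank_add (diag_mx x) (diag_mx y); rewrite r1 => h.
have := rank_diag_le y; rewrite (eq_card (B := [predC [pred k | x 0 k != 0]])); last first.
  by move=> k; rewrite !inE mxE pnatr_eq0 eqb0 negbK.
move=> hy; rewrite -(leq_add2r #|[predC [pred k | x 0%R k != 0%R]]|) cardC card_ord.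
by apply: leq_trans h _; rewrite leq_add2l.
Qed.

Lemma card_eval r : psd r -> (#|[pred k | eval r k != 0%R]| <= \rank r)%N.
Proof.
move=> pr; rewrite {2}(spectral pr) /diagconj.
rewrite mxrankMfree ?row_free_unit ?evec_unit // -mxrank_tr trmx_mul.
rewrite mxrankMfree ?row_free_unit ?unitmx_tr ?unitmx_inv ?evec_unit // mxrank_tr.
apply: leq_trans (rank_diag_ge _); rewrite subset_leq_card //; apply/subsetP => k.
by rewrite !inE mxE (inj_eq (@complexI _)) sqrf_eq0.
Qed.

(** The squared moduli of the entries of the unitary between the two eigenbases. They form a doubly
    stochastic matrix, by [sum_overlap] and [overlapC]. *)
Definition overlap r s (i j : 'I_d) : R :=
  complex.Re ((evec r *m invmx (evec s)) i j * ((evec r *m invmx (evec s)) i j)^*).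

Lemma overlapE r s i j : (overlap r s i j)%:C =
  (evec r *m invmx (evec s)) i j * ((evec r *m invmx (evec s)) i j)^*.
Proof. by rewrite /overlap RRe_real // -normCK ger0_real // exprn_ge0. Qed.

Lemma overlap_conj r s i j :
  ((evec r *m invmx (evec s)) i j)^* = (evec s *m invmx (evec r)) j i.
Proof.
rewrite !invmx_unitary ?evec_unitary // !mxE rmorph_sum; apply: eq_bigr => k _.
by rewrite !mxE rmorphM /= conjCK mulrC.
Qed.

Lemma overlap_ge0 r s i j : 0 <= overlap r s i j.
Proof. by rewrite -ler0c overlapE -normCK exprn_ge0. Qed.

Lemma overlapC r s i j : overlap r s i j = overlap s r j i.
Proof. by apply: complexI; rewrite !overlapE !overlap_conj mulrC. Qed.

Lemma sum_overlap r s i : \sum_j overlap r s i j = 1.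
Proof.
apply: complexI; rewrite rmorph_sum /=.
transitivity ((evec r *m invmx (evec s) *m (evec s *m invmx (evec r))) i i).
  by rewrite [RHS]mxE; apply: eq_bigr => j _; rewrite overlapE overlap_conj.
by rewrite mulmxA mulmxKV ?evec_unit // mulmxV ?evec_unit // mxE eqxx.
Qed.

Lemma tr_diagconj2 r s x y :
  \tr (diagconj (evec r) x *m diagconj (evec s) y) =
  \sum_i \sum_j x i * y j * (overlap r s i j)%:C.
Proof.
rewrite /diagconj tr_conjmx2; apply: eq_bigr => i _.
rewrite mxE; apply: eq_bigr => j _; rewrite overlapE overlap_conj.
rewrite /dmx !mul_diag_mx; set U := _ *m _; set V := _ *m _.
by rewrite mxE [X in _ * X]mxE !mxE; ring.
Qed.

(* tr(r f(r) g(s)) *)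
Definition spectral_form (f g : R -> Cplx) r s : Cplx :=
  \sum_i \sum_j (eval r i ^+ 2)%:C * f (eval r i ^+ 2) * g (eval s j ^+ 2) * (overlap r s i j)%:C.


Lemma mprod_diagconj P cs (x : 'I_d -> R) : P \in unitmx ->
  mprod cs (diagconj P (fun k => (x k)%:C)) = diagconj P (fun k => lprod cs (x k)).
Proof.
move=> uP; elim: cs => [|[c t] cs IH] /=.
  rewrite -(diagconj_scalar 1 uP); apply: eq_diagconj => k.
  by rewrite /lprod big_nil.
rewrite IH -(diagconj_scalar _ uP) diagconjZ diagconjD (diagconjM _ _ uP).
apply: eq_diagconj => k; rewrite /lprod big_cons /=; congr (_ * _).
by rewrite [RHS]complexE /= rmorphM [Complex 0 t]complexE /= add0r mulrA.
Qed.

Lemma tr_mprod cs cs' r s : density r -> density s ->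
  \tr (r *m (mprod cs r *m mprod cs' s)) = spectral_form (lprod cs) (lprod cs') r s.
Proof.
move=> [pr _] [ps _]; rewrite mulmxA.
have -> : r *m mprod cs r = diagconj (evec r) (fun k => (eval r k ^+ 2)%:C * lprod cs (eval r k ^+ 2)).
  by rewrite -(diagconjM _ _ (evec_unit r)) -(mprod_diagconj _ _ (evec_unit r)) -spectral.
have -> : mprod cs' s = diagconj (evec s) (fun k => lprod cs' (eval s k ^+ 2)).
  by rewrite -(mprod_diagconj _ _ (evec_unit s)) -spectral.
exact: tr_diagconj2.
Qed.

(** The form is bilinear in f and g, so a nested induction on the two derivations of [hull] reduces
    it to products of factors, and the weights multiply. *)
Lemma observable_spectral_form n f g m m' : hull n f m -> hull n g m' -> observable (probe d n) (spectral_form f g) (m * m').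
Proof.
move=> hf; elim: hf g m' => {f m} [cs sz u|f f' m m1 _ IH _ IH'|t f m t0 _ IH|f m _ IH|f f' m e _ IH] g m' hg.
- rewrite mul1r; elim: hg => {g m'} [cs' sz' u'|g g' m m1 _ IH _ IH'|t g m t0 _ IH|g m _ IH|g g' m e _ IH].
  + by apply: observable_ext (observable_mprod d u u' sz sz') => r s dr ds; rewrite tr_mprod.
  + apply: observable_ext (observable_add IH IH') => r s _ _; rewrite /spectral_form -big_split; apply: eq_bigr => i _.
    by rewrite -big_split; apply: eq_bigr => j _ /=; ring.
  + apply: observable_ext (observable_scale t0 IH) => r s _ _; rewrite /spectral_form mulr_sumr; apply: eq_bigr => i _.
    by rewrite mulr_sumr; apply: eq_bigr => j _ /=; ring.
  + apply: observable_ext (observable_i IH) => r s _ _; rewrite /spectral_form mulr_sumr; apply: eq_bigr => i _.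
    by rewrite mulr_sumr; apply: eq_bigr => j _ /=; ring.
  + by apply: observable_ext IH => r s _ _; apply: eq_bigr => i _; apply: eq_bigr => j _; rewrite e.
- rewrite mulrDl; apply: observable_ext (observable_add (IH _ _ hg) (IH' _ _ hg)) => r s _ _.
  rewrite /spectral_form -big_split; apply: eq_bigr => i _.
  by rewrite -big_split; apply: eq_bigr => j _ /=; ring.
- rewrite -mulrA; apply: observable_ext (observable_scale t0 (IH _ _ hg)) => r s _ _.
  rewrite /spectral_form mulr_sumr; apply: eq_bigr => i _.
  by rewrite mulr_sumr; apply: eq_bigr => j _ /=; ring.
- apply: observable_ext (observable_i (IH _ _ hg)) => r s _ _; rewrite /spectral_form mulr_sumr; apply: eq_bigr => i _.
  by rewrite mulr_sumr; apply: eq_bigr => j _ /=; ring.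
- by apply: observable_ext (IH _ _ hg) => r s _ _; apply: eq_bigr => i _; apply: eq_bigr => j _; rewrite e.
Qed.

(** This is tr(√ρ √σ) expanded in the two eigenbases. *)
Definition affinity r s : R := \sum_i \sum_j eval r i * eval s j * overlap r s i j.

Lemma affinity_ge0 r s : density r -> density s -> 0 <= affinity r s.
Proof.
move=> [pr _] [ps _]; apply: sumr_ge0 => i _; apply: sumr_ge0 => j _.
by rewrite !mulr_ge0 ?eval_ge0 ?overlap_ge0.
Qed.

Lemma hellingerE r s : density r -> density s ->
  hellinger r s = Num.sqrt (1 - affinity r s).
Proof.
move=> dr ds; have [pr tr1] := dr; have [ps ts1] := ds; rewrite /hellinger; congr (Num.sqrt _).
have trS : \tr (psd_sqrt r *m psd_sqrt s) = (affinity r s)%:C.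
  rewrite !sqrt_spectral // tr_diagconj2 rmorph_sum; apply: eq_bigr => i _.
  by rewrite rmorph_sum; apply: eq_bigr => j _ /=; rewrite !rmorphM.
rewrite tr_sqr_diff trS.
have [_ ->] := psd_sqrtP pr; have [_ ->] := psd_sqrtP ps; rewrite tr1 ts1.
by rewrite mulr_natl mulr2n ReD ReB ReD /=; field.
Qed.

(* Cauchy-Schwarz on the support of [eval r]. *)
Lemma sum_eval_le r (n : nat) : density r -> (\rank r <= n)%N -> \sum_k eval r k <= Num.sqrt n%:R.
Proof.
move=> dr rn; have [pr _] := dr; have cn := leq_trans (card_eval pr) rn.
have c1 : \sum_k (eval r k != 0)%:R <= n%:R :> R.
  by rewrite -natr_sum ler_nat (leq_trans _ cn) // -sum1_card [X in (_ <= X)%N]big_mkcond; apply: leq_sum => k _; rewrite inE; case: (_ != _).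
apply: le_of_sqr; rewrite ?sqrtr_ge0 // sqr_sqrtr //; apply: le_trans c1.
set T := \sum_k eval r k; set C := \sum_k (eval r k != 0)%:R.
have C0 : 0 <= C by apply: sumr_ge0 => k _.
have : 0 <= \sum_k (T * eval r k - (eval r k != 0)%:R) ^+ 2.
  by apply: sumr_ge0 => k _; exact: sqr_ge0.
rewrite (eq_bigr (fun k => T ^+ 2 * eval r k ^+ 2 + (- (2 * T) * eval r k + (eval r k != 0)%:R))); last first.
  by move=> k _; case: eqP => [->|_] /=; ring.
by rewrite !big_split /= -!mulr_sumr sum_eval_sqr // -/T -/C; nra.
Qed.

(** Split g(a²) g(b²) - ab as (g(a²) - a) b + g(a²) (g(b²) - b). As [overlap] is doubly stochastic,
    each part reduces to a sum over a single spectrum, which the rank controls. *)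
Lemma spectral_form_err (g : R -> R) (eta : R) (n : nat) r s : density r -> density s ->
  (\rank r <= n)%N -> (\rank s <= n)%N -> 0 <= eta -> g 0 = 0 ->
  (forall a, 0 <= a <= 1 -> `|g (a ^+ 2) - a| <= eta) ->
  `|\sum_i \sum_j g (eval r i ^+ 2) * g (eval s j ^+ 2) * overlap r s i j - affinity r s|
    <= eta * (2 * Num.sqrt n%:R + n%:R * eta).
Proof.
move=> dr ds rn sn e0 g0 ge; have [pr _] := dr; have [ps _] := ds.
have E q k : density q -> `|g (eval q k ^+ 2) - eval q k| <= eta * (eval q k != 0)%:R.
  move=> dq; have [pq _] := dq; case: eqP => [->|_]; first by rewrite expr0n g0 subr0 normr0 mulr0.
  by rewrite mulr1 ge // eval_ge0 // eval_le1.
have E1 q k : density q -> `|g (eval q k ^+ 2) - eval q k| <= eta.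
  by move=> dq; apply: le_trans (E q k dq) _; rewrite ler_piMr // lern1 leq_b1.
rewrite /affinity -sumrB.
have -> : \sum_i (\sum_j g (eval r i ^+ 2) * g (eval s j ^+ 2) * overlap r s i j -
     \sum_j eval r i * eval s j * overlap r s i j) =
   \sum_i \sum_j (g (eval r i ^+ 2) - eval r i) * eval s j * overlap r s i j +
   \sum_i \sum_j g (eval r i ^+ 2) * (g (eval s j ^+ 2) - eval s j) * overlap r s i j.
  rewrite -big_split; apply: eq_bigr => i _; rewrite -sumrB -big_split.
  by apply: eq_bigr => j _ /=; ring.
apply: le_trans (ler_normD _ _) _.
have S1 : `|\sum_i \sum_j (g (eval r i ^+ 2) - eval r i) * eval s j * overlap r s i j| <= eta * Num.sqrt n%:R.
  apply: le_trans (ler_norm_sum _ _ _) _.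
  apply: (@le_trans _ _ (\sum_i \sum_j eta * eval s j * overlap r s i j)).
    apply: ler_sum => i _; apply: le_trans (ler_norm_sum _ _ _) _; apply: ler_sum => j _.
    rewrite !normrM (ger0_norm (eval_ge0 _ ps)) (ger0_norm (overlap_ge0 _ _ _ _)).
    by rewrite !ler_wpM2r ?overlap_ge0 ?eval_ge0 ?E1.
  rewrite exchange_big /= (eq_bigr (fun j => eta * eval s j)) => [|j _].
    by rewrite -mulr_sumr ler_wpM2l // sum_eval_le.
  rewrite -mulr_sumr (eq_bigr (fun i => overlap s r j i)) ?sum_overlap ?mulr1 // => i _.
  exact: overlapC.
have S2 : `|\sum_i \sum_j g (eval r i ^+ 2) * (g (eval s j ^+ 2) - eval s j) * overlap r s i j|
    <= eta * (Num.sqrt n%:R + n%:R * eta).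
  apply: le_trans (ler_norm_sum _ _ _) _.
  (* Since g vanishes at 0, the excess of |g(a²)| over a is charged only to the at most n nonzero
     eigenvalues. *)
  apply: (@le_trans _ _ (\sum_i eta * (eval r i + eta * (eval r i != 0)%:R))).
    apply: ler_sum => i _; apply: le_trans (ler_norm_sum _ _ _) _.
    apply: (@le_trans _ _ (\sum_j (eta * (eval r i + eta * (eval r i != 0)%:R)) * overlap r s i j)).
      apply: ler_sum => j _; rewrite !normrM (ger0_norm (overlap_ge0 _ _ _ _)).
      rewrite ler_wpM2r ?overlap_ge0 // mulrC ler_pM // ?E1 //.
      have := E r i dr; have := eval_ge0 i pr; rewrite ler_distl.
      have := g0; move: (eval r i) => a _ a0 /andP[h1 h2].
      by rewrite ler_norml; apply/andP; split; lra.
    by rewrite -mulr_sumr sum_overlap mulr1.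
  rewrite -mulr_sumr ler_wpM2l // big_split lerD // ?sum_eval_le // -mulr_sumr mulrC.
  rewrite ler_wpM2r // -natr_sum ler_nat (leq_trans _ (leq_trans (card_eval pr) rn)) //.
  by rewrite -sum1_card [X in (_ <= X)%N]big_mkcond; apply: leq_sum => k _; rewrite inE; case: (_ != _).
by apply: le_trans (lerD S1 S2) _; lra.
Qed.

End Spectral.
(** * Tests with repetition *)

Section Tests.
Variable d : nat.
Local Notation M := 'M[Cplx]_d.
Local Notation space := (space d).
Local Notation point := (point d).
Implicit Types I J K : space.

Definition testable I (p : M -> M -> R) : Prop :=
  exists E : I -> I -> Cplx, [/\ gram E, gram (fun i j => kron i j - E i j) &
    forall r s, density r -> density s -> ktrace E (st r s) = (p r s)%:C].

Lemma testable_ext I p q : (forall r s, density r -> density s -> p r s = q r s) -> testable I p -> testable I q.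
Proof. by move=> e [E [g1 g2 h]]; exists E; split=> // r s dr ds; rewrite h // e. Qed.

Lemma gram0 (T : finType) : gram (fun _ _ : T => 0).
Proof. by apply: eq_gram (gram_scale (lexx 0) (gram_kron T)) => i j; rewrite rmorph0 mul0r. Qed.

Lemma testable1 I : state_space I -> testable I (fun _ _ => 1).
Proof.
move=> gI; exists (@kron I); split; first exact: gram_kron.
  by apply: eq_gram (gram0 I) => i j; rewrite subrr.
by move=> r s dr ds; rewrite ktrace_kron; have [-> _] := gI r s dr ds.
Qed.

Lemma testable0 I : testable I (fun _ _ => 0).
Proof.
exists (fun _ _ => 0); split; first exact: gram0.
  by apply: eq_gram (gram_kron I) => i j; rewrite subr0.
by move=> r s _ _; rewrite /ktrace big1 // => i _; rewrite big1 // => j _; rewrite mul0r.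
Qed.

Lemma testable_observable I F m : 0 < m -> observable I F m -> testable I (fun r s => 1 / 2 + complex.Re (F r s) / (2 * m)).
Proof.
move=> m0 h; have [E1 [E2 [g1 g2 E12 tE]]] := h 1 (normr1 _).
have mV : (m^-1)%:C * m%:C = 1 by rewrite -rmorphM /= mulVf ?rmorph1 ?lt0r_neq0.
have mi : 0 <= m^-1 by rewrite invr_ge0 ltW.
exists (fun i j => (m^-1)%:C * E1 i j); split; first exact: gram_scale.
  apply: eq_gram (gram_scale mi g2) => i j.
  by rewrite -[kron i j]mul1r -mV -mulrA -E12 mulrDr addrAC subrr add0r.
move=> r s dr ds; rewrite ktrace_scale tE // mul1r -rmorphM /=; congr (_ %:C).
by field; rewrite lt0r_neq0.
Qed.

(* Measure [I] first, then choose the measurement of [J] according to the outcome. *)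
Lemma testable_branch I J p q q' : state_space I -> testable I p -> testable J q -> testable J q' ->
  testable (prods I J) (fun r s => p r s * q r s + (1 - p r s) * q' r s).
Proof.
move=> gI [E [g1 g2 tE]] [F [f1 f2 tF]] [F' [f1' f2' tF']].
exists (fun x y : I * J => E x.1 y.1 * F x.2 y.2 + (kron x.1 y.1 - E x.1 y.1) * F' x.2 y.2); split.
- exact: gram_add (gram_tens g1 f1) (gram_tens g2 f1').
- apply: eq_gram (gram_add (gram_tens g1 f2) (gram_tens g2 f2')) => -[i j] [i' j'] /=.
  have -> : kron (i, j) (i', j') = kron i i' * kron j j'.
    by rewrite /kron -natrM mulnb xpair_eqE.
  ring.
move=> r s dr ds; rewrite ktrace_add (ktrace_tens E (st r s) F (st r s)).
rewrite (ktrace_tens (fun i j => kron i j - E i j) (st r s) F' (st r s)) tF // tF' // tE //.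
have -> : ktrace (fun i j => kron i j - E i j) (st r s) = (1 - p r s)%:C.
  rewrite (eq_ktrace (F := fun i j => kron i j + (-1) * E i j)) => [|i j]; last by rewrite mulN1r.
  rewrite ktrace_add ktrace_scale tE // ktrace_kron; have [-> _] := gI r s dr ds.
  by rewrite mulN1r rmorphB rmorph1.
by rewrite [RHS]rmorphD /= !rmorphM.
Qed.

(** A relabelling of basis states that respects the state for all inputs; it replaces equalities
    between tensor products of different shape. *)
Definition iso I J : Prop := exists2 h : J -> I, bijective h &
  forall r s x y, st r s (h x) (h y) = st r s x y.

Lemma testable_iso I J p : iso I J -> testable I p -> testable J p.
Proof.
move=> [h bh e] [E [g1 g2 tE]]; exists (fun x y => E (h x) (h y)); split.
- exact: gram_pull.
- apply: eq_gram (gram_pull h g2) => x y.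
  by rewrite /kron (inj_eq (bij_inj bh)).
move=> r s dr ds; rewrite -tE // /ktrace (reindex h) /=; last exact: onW_bij.
apply: eq_bigr => x _; rewrite [RHS](reindex h) /=; last exact: onW_bij.
by apply: eq_bigr => y _; rewrite e.
Qed.

Lemma iso_refl I : iso I I.
Proof. by exists id => //; exists id. Qed.

Lemma iso_sym I J : iso I J -> iso J I.
Proof.
move=> [h [g hK gK] e]; exists g; first by exists h.
by move=> r s x y; rewrite -e !gK.
Qed.

Lemma iso_trans J I K : iso I J -> iso J K -> iso I K.
Proof.
move=> [h bh e] [g bg e']; exists (h \o g); first exact: bij_comp.
by move=> r s x y; rewrite /= e e'.
Qed.

Lemma iso_prods I I' J J' : iso I I' -> iso J J' -> iso (prods I J) (prods I' J').
Proof.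
move=> [h [h' hK h'K] e] [g [g' gK g'K] e'].
exists (fun x : I' * J' => (h x.1, g x.2)).
  by exists (fun x : I * J => (h' x.1, g' x.2)) => -[x y] /=; rewrite ?hK ?gK ?h'K ?g'K.
by move=> r s x y /=; rewrite e e'.
Qed.

Lemma iso_assoc I J K : iso (prods (prods I J) K) (prods I (prods J K)).
Proof.
exists (fun x : I * (J * K) => ((x.1, x.2.1), x.2.2)).
  by exists (fun x : I * J * K => (x.1.1, (x.1.2, x.2))) => [[x [y z]]|[[x y] z]].
by move=> r s x y /=; rewrite mulrA.
Qed.

Lemma iso_swap I J K : iso (prods I (prods J K)) (prods J (prods I K)).
Proof.
exists (fun x : J * (I * K) => (x.2.1, (x.1, x.2.2))).
  by exists (fun x : I * (J * K) => (x.2.1, (x.1, x.2.2))) => [[x [y z]]|[x [y z]]].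
by move=> r s x y /=; rewrite mulrCA.
Qed.

Lemma iso_point I : iso (prods point I) I.
Proof.
exists (fun x : I => (tt, x)); first by exists (fun x : unit * I => x.2) => [x|[[] x]].
by move=> r s x y /=; rewrite mul1r.
Qed.

Definition power b k : space :=
  @Space d 'I_(d ^ k) (fun r s i j => ((if b then r else s) ^t k) i j).

Definition samples k l : space :=
  @Space d 'I_(d ^ k * d ^ l) (fun r s i j => ((r ^t k) *t (s ^t l)) i j).

Lemma iso_samples k l : iso (prods (power true k) (power false l)) (samples k l).
Proof.
exists (@mxtens_unindex (d ^ k) (d ^ l)).
  exists (@mxtens_index (d ^ k) (d ^ l)); [exact: mxtens_unindexK | exact: mxtens_indexK].
by move=> r s x y; rewrite /= mxE.
Qed.

Lemma iso_powerS b k : iso (prods (single d b) (power b k)) (power b k.+1).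
Proof.
(* The first tensor power is the matrix itself, without a trailing factor of dimension 1, so k = 0
   is treated apart. *)
case: k => [|k].
  exists (fun x : 'I_d => (x, ord0 : 'I_1)).
    by exists (fun x : 'I_d * 'I_1 => x.1) => [x|[x y]] //=; rewrite [y]ord1.
  by move=> r s x y /=; rewrite mxE eqxx mulr1.
exists (@mxtens_unindex d (d ^ k.+1)).
  exists (@mxtens_index d (d ^ k.+1)); [exact: mxtens_unindexK | exact: mxtens_indexK].
by move=> r s x y /=; rewrite mxE.
Qed.

Lemma iso_copy_true k l : iso (copy true (samples k l)) (samples k.+1 l).
Proof.
apply: iso_trans (iso_prods (iso_refl _) (iso_sym (iso_samples k l))) _.
apply: iso_trans (iso_sym (iso_assoc _ _ _)) _.
exact: iso_trans (iso_prods (iso_powerS true k) (iso_refl _)) (iso_samples _ _).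
Qed.

Lemma iso_copy_false k l : iso (copy false (samples k l)) (samples k l.+1).
Proof.
apply: iso_trans (iso_prods (iso_refl _) (iso_sym (iso_samples k l))) _.
apply: iso_trans (iso_swap _ _ _) _.
exact: iso_trans (iso_prods (iso_refl _) (iso_powerS false l)) (iso_samples _ _).
Qed.

Lemma iso_samples0 : iso point (samples 0 0).
Proof.
exists (fun x : 'I_(1 * 1) => tt).
  by exists (fun x : unit => ord0 : 'I_(1 * 1)) => [x|[]] //; apply/val_inj; case: x => [[|]].
move=> r s x y /=; rewrite mxE /= !mxE.
by rewrite (_ : _ == _); [rewrite (_ : _ == _) ?mulr1 //|]; rewrite ord1 [X in _ == X]ord1.
Qed.

Lemma iso_prods_samples k l k' l' : iso (prods (samples k l) (samples k' l')) (samples (k + k') (l + l')).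
Proof.
elim: k => [|k IH].
  elim: l => [|l IH].
    exact: iso_trans (iso_prods (iso_sym iso_samples0) (iso_refl _)) (iso_point _).
  apply: iso_trans (iso_prods (iso_sym (iso_copy_false _ _)) (iso_refl _)) _.
  apply: iso_trans (iso_assoc _ _ _) _.
  exact: iso_trans (iso_prods (iso_refl _) IH) (iso_copy_false _ _).
apply: iso_trans (iso_prods (iso_sym (iso_copy_true _ _)) (iso_refl _)) _.
apply: iso_trans (iso_assoc _ _ _) _.
exact: iso_trans (iso_prods (iso_refl _) IH) (iso_copy_true _ _).
Qed.

Lemma iso_probe n : iso (probe d n) (samples n.+1 n).
Proof.
have i1 m : iso (copies false m point) (samples 0 m).
  elim: m => [|m IH]; first exact: iso_samples0.
  exact: iso_trans (iso_prods (iso_refl _) IH) (iso_copy_false _ _).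
have i2 m : iso (copies true m (copies false n point)) (samples m n).
  elim: m => [|m IH]; first exact: i1.
  exact: iso_trans (iso_prods (iso_refl _) IH) (iso_copy_true _ _).
exact: iso_trans (iso_prods (iso_refl _) (i2 n)) (iso_copy_true _ _).
Qed.

(* Expectation of [f] at a binomial variable with parameters [n] and [p]. *)
Fixpoint binmean (n : nat) (p : R) (f : nat -> R) : R :=
  if n is m.+1 then p * binmean m p (fun k => f k.+1) + (1 - p) * binmean m p f else f 0%N.

Fixpoint repeat_space n I : space := if n is m.+1 then prods I (repeat_space m I) else point.

(** The set f of accepted counts is generalized: after a success the remaining runs are judged by
    the shifted set. *)
Lemma testable_bin n I p (f : nat -> bool) : state_space I -> testable I p ->
  testable (repeat_space n I) (fun r s => binmean n (p r s) (fun k => (f k)%:R)).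
Proof.
move=> gI hp; elim: n f => [|n IH] f /=.
  case: (f 0%N); last by apply: (@testable_ext _ (fun _ _ => 0)); [by [] | apply: testable0].
  by apply: (@testable_ext _ (fun _ _ => 1)); [by [] | apply: testable1; apply: state_space_point].
exact: testable_branch gI hp (IH (fun k => f k.+1)) (IH f).
Qed.

Lemma iso_repeat_space n I k l : iso I (samples k l) -> iso (repeat_space n I) (samples (n * k) (n * l)).
Proof.
move=> h; elim: n => [|n IH]; first exact: iso_samples0.
by rewrite !mulSn; exact: iso_trans (iso_prods h IH) (iso_prods_samples _ _ _ _).
Qed.

End Tests.

(** * Binomial averages and Chebyshev's inequality *)

Lemma eq_binmean n p f g : f =1 g -> binmean n p f = binmean n p g.
Proof.
elim: n f g => [|n IH] f g e /=; first exact: e.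
by rewrite (IH _ (fun k => g k.+1)) ?(IH f g) // => k; rewrite e.
Qed.

Lemma binmean_le n p f g : 0 <= p <= 1 -> (forall k, f k <= g k) -> binmean n p f <= binmean n p g.
Proof.
move=> /andP[p0 p1]; elim: n f g => [|n IH] f g e /=; first exact: e.
by rewrite lerD // ler_wpM2l ?subr_ge0 // IH.
Qed.

Lemma binmean_scale n p t f : binmean n p (fun k => t * f k) = t * binmean n p f.
Proof. by elim: n f => [|n IH] f //=; rewrite !IH; ring. Qed.

Lemma binmean_compl n p f : binmean n p (fun k => 1 - f k) = 1 - binmean n p f.
Proof. by elim: n f => [|n IH] f //=; rewrite !IH; ring. Qed.

(** Squared bias plus variance. The centre a is arbitrary because the induction shifts it by 1. *)
Lemma binmean_sqr n p a : binmean n p (fun k => (k%:R - a) ^+ 2) =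
  (n%:R * p - a) ^+ 2 + n%:R * p * (1 - p).
Proof.
elim: n a => [|n IH] a /=; first by rewrite !mul0r addr0.
rewrite (eq_binmean _ _ (g := fun k => (k%:R - (a - 1)) ^+ 2)) => [|k].
  by rewrite !IH -natr1; ring.
by rewrite -natr1; congr (_ ^+ 2); ring.
Qed.

(** Since p (1 - p) <= 1/4, Chebyshev's bound is 1 / (4 n t^2), which is at most 1/3. *)
Lemma binmean_cheb n p t (b : nat -> bool) : 0 <= p <= 1 -> (0 < n)%N -> 3 <= 4 * n%:R * t ^+ 2 -> 0 < t ->
  (forall k, b k -> n%:R * t <= `|k%:R - n%:R * p|) ->
  binmean n p (fun k => (b k)%:R) <= 1 / 3.
Proof.
move=> p01 n0 nt t0 hb; have n0' : 0 < n%:R :> R by rewrite ltr0n.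
have nt0 : 0 < (n%:R * t) ^+ 2 by rewrite exprn_gt0 // mulr_gt0.
apply: (@le_trans _ _ (binmean n p (fun k => ((n%:R * t) ^+ 2)^-1 * (k%:R - n%:R * p) ^+ 2))).
  apply: binmean_le => // k; rewrite mulrC ler_pdivlMr //.
  case E: (b k); last by rewrite mul0r sqr_ge0.
  rewrite mul1r -[X in _ <= X]real_normK ?num_real // ler_sqr ?nnegrE ?hb //.
  by rewrite ltW // mulr_gt0.
rewrite binmean_scale binmean_sqr subrr expr0n add0r mulrC ler_pdivrMr //.
have [p0 p1] := andP p01.
have pq : p * (1 - p) <= 4^-1 by have := sqr_ge0 (p - 1 / 2); lra.
rewrite -mulrA exprMn; move: (n%:R : R) n0' nt => m m0 nt.
apply: (@le_trans _ _ (m * 4^-1)); first by rewrite ler_pM2l.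
rewrite (_ : 1 / 3 * (m ^+ 2 * t ^+ 2) = m * (1 / 12 * (4 * m * t ^+ 2))); last by field.
rewrite ler_pM2l //; lra.
Qed.

Lemma binmean_test n p th t : 0 <= p <= 1 -> (0 < n)%N -> 3 <= 4 * n%:R * t ^+ 2 -> 0 < t ->
  (th + t <= p -> 2 / 3 <= binmean n p (fun k => ((n%:R * th <= k%:R)%R : nat)%:R)) /\
  (p <= th - t -> 2 / 3 <= 1 - binmean n p (fun k => ((n%:R * th <= k%:R)%R : nat)%:R)).
Proof.
move=> p01 n0 nt t0; have n0' : 0 < n%:R :> R by rewrite ltr0n.
split=> hp.
  have : binmean n p (fun k => (~~ (n%:R * th <= k%:R))%:R) <= 1 / 3.
    apply: (binmean_cheb p01 n0 nt t0) => k; rewrite -ltNge => hk.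
    have : n%:R * (th + t) <= n%:R * p by rewrite ler_pM2l.
    by rewrite mulrDr ler_normr => h; apply/orP; right; lra.
  rewrite (eq_binmean _ _ (g := fun k => 1 - ((n%:R * th <= k%:R)%R : nat)%:R)) => [|k].
    by rewrite binmean_compl; lra.
  by case: (_ <= _); rewrite ?subrr ?subr0.
have : binmean n p (fun k => ((n%:R * th <= k%:R)%R : nat)%:R) <= 1 / 3.
  apply: (binmean_cheb p01 n0 nt t0) => k hk.
  have : n%:R * p <= n%:R * (th - t) by rewrite ler_pM2l.
  by rewrite mulrBr ler_normr => h; apply/orP; left; lra.
lra.
Qed.

(** * From tests to quantum algorithms *)

Lemma psd_adj_mul m n (B : 'M[Cplx]_(m, n)) : psd (adj B *m B).
Proof.
move=> v; rewrite mulmxA -adj_mul -mulmxA mxE; apply: sumr_ge0 => k _.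
by rewrite !mxE mulrC -normCK exprn_ge0.
Qed.

Lemma psd_gram n (I : finType) (h : 'I_n -> I) (E : I -> I -> Cplx) : gram E ->
  psd (\matrix_(i < n, j < n) E (h i) (h j)).
Proof.
move=> [K [B hB]]; set A := \matrix_(i, j) _.
pose C : 'M[Cplx]_(#|K|, n) := \matrix_(a, j) B (enum_val a) (h j).
suff -> : A = adj C *m C by apply: psd_adj_mul.
apply/matrixP => i j; rewrite !mxE hB big_enum_val /=.
by apply: eq_bigr => a _; rewrite !mxE.
Qed.

(** The algorithm has an ancilla of dimension 1 and the identity channel; the whole test sits in the
    effect, transported along [h] from N * 1 to N indices. *)
Lemma qalg_of_testable d k l p : testable (samples d k l) p ->
  exists2 A : qalg (d ^ k * d ^ l), qalg_valid A &
  forall r s : 'M[Cplx]_d, density r -> density s -> accept_prob A ((r ^t k) *t (s ^t l)) = p r s.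
Proof.
move=> [E [g1 g2 tE]]; set N := (d ^ k * d ^ l)%N in E g1 g2 tE *.
pose h (i : 'I_(N * 1)) : 'I_N := (mxtens_unindex i).1.
have h_inj : injective h.
  move=> i j e; rewrite -(mxtens_unindexK i) -(mxtens_unindexK j); congr mxtens_index.
  move: e; rewrite /h; case: (mxtens_unindex i) (mxtens_unindex j) => [a b] [a' b'] /= ->.
  by rewrite [b]ord1 [b']ord1.
exists (@QAlg N 1 1%:M (N * 1) 1 (fun _ => 1%:M) (\matrix_(i, j) E (h i) (h j))).
  have adj1 n : adj (1%:M : 'M[Cplx]_n) = 1%:M by rewrite /adj map_mx1 trmx1.
  split; [|split; [|split]] => /=.
  - split; last by rewrite mxtrace1.
    by have := psd_adj_mul (1%:M : 'M[Cplx]_1); rewrite adj1 mulmx1.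
  - by rewrite big_ord1 adj1 mulmx1.
  - exact: psd_gram.
  - have -> : 1%:M - \matrix_(i, j) E (h i) (h j) = \matrix_(i, j) (kron (h i) (h j) - E (h i) (h j)).
      by apply/matrixP => i j; rewrite !mxE /kron (inj_eq h_inj).
    exact: psd_gram (fun i j => kron i j - E i j) g2.
move=> r s dr ds; have := tE r s dr ds; rewrite /accept_prob /qalg_channel /= big_ord1.
rewrite /adj map_mx1 trmx1 mulmx1 mul1mx /=.
set T := _ *t _ => tT; suff -> : \tr (\matrix_(i, j) E (h i) (h j) *m (T *t 1%:M)) = (p r s)%:C by [].
have sumh (f : 'I_N -> Cplx) : \sum_i f (h i) = \sum_i f i.
  rewrite (reindex (@mxtens_index N 1)) /=; last first.
    apply: onW_bij; exists (@mxtens_unindex N 1); [exact: mxtens_indexK | exact: mxtens_unindexK].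
  rewrite sum_pair; apply: eq_bigr => i _; rewrite big_ord1 /h mxtens_indexK //.
rewrite -tT /ktrace -sumh; apply: eq_bigr => i _; rewrite mxE -sumh; apply: eq_bigr => j _.
rewrite [X in X * _]mxE [X in _ * X]mxE [X in _ * (_ * X)]mxE.
by rewrite [(mxtens_unindex j).2]ord1 [(mxtens_unindex i).2]ord1 mulr1.
Qed.
(** * Sample complexity *)

(** Use ab <= (a^2 + b^2) / 2 and sum with the doubly stochastic weights. *)
Lemma affinity_le1 d (r s : 'M[Cplx]_d) : density r -> density s -> affinity r s <= 1.
Proof.
move=> dr ds.
apply: (@le_trans _ _ (\sum_i \sum_j (2^-1 * eval r i ^+ 2 * overlap r s i j +
                                      2^-1 * eval s j ^+ 2 * overlap r s i j))).
  apply: ler_sum => i _; apply: ler_sum => j _; rewrite -mulrDl ler_wpM2r ?overlap_ge0 //.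
  by have := sqr_ge0 (eval r i - eval s j); lra.
rewrite (eq_bigr (fun i => \sum_j 2^-1 * eval r i ^+ 2 * overlap r s i j +
   \sum_j 2^-1 * eval s j ^+ 2 * overlap r s i j)) => [|i _]; last by rewrite big_split.
rewrite big_split /= (exchange_big _ _ _ _ _ (fun i j => 2^-1 * eval s j ^+ 2 * _)) /=.
rewrite (eq_bigr (fun i => 2^-1 * eval r i ^+ 2)) => [|i _]; last first.
  by rewrite -mulr_sumr sum_overlap mulr1.
rewrite [X in _ + X](eq_bigr (fun j => 2^-1 * eval s j ^+ 2)) => [|j _]; last first.
  rewrite -mulr_sumr (eq_bigr (fun i => overlap s r j i)) ?sum_overlap ?mulr1 // => i _.
  exact: overlapC.
by rewrite -!mulr_sumr !sum_eval_sqr //; lra.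
Qed.

Lemma Re_spectral_form d (f : R -> Cplx) (g : R -> R) (r s : 'M[Cplx]_d) :
  (forall x, (g x)%:C = x%:C * f x) ->
  complex.Re (spectral_form f (fun x => (g x)%:C) r s) =
  \sum_i \sum_j g (eval r i ^+ 2) * g (eval s j ^+ 2) * overlap r s i j.
Proof.
move=> h; rewrite /spectral_form Re_sum; apply: eq_bigr => i _; rewrite Re_sum; apply: eq_bigr => j _.
by rewrite -h -!rmorphM.
Qed.

(** The gap e in the affinity leaves e/4 on each side of the midpoint for the approximation and e/4
    for the sampling. The statistics has range M = 3 √K, and 432 is what Chebyshev's condition 3 <=
    4 m t^2 requires for t = e / (8 M). *)
Lemma affinity_test (d n K m : nat) (a e : R) :
  (0 < K)%N -> (0 < m)%N -> 0 < e <= 1 ->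
  4 * Num.sqrt K%:R^-1 * (2 * Num.sqrt n%:R + n%:R * (4 * Num.sqrt K%:R^-1)) <= e / 4 ->
  432 * K%:R <= m%:R * e ^+ 2 ->
  exists2 A : qalg (d ^ (m * (K ^ 2).+1) * d ^ (m * K ^ 2)), qalg_valid A &
  forall r s : 'M[Cplx]_d, density r -> density s ->
    (\rank r <= n)%N -> (\rank s <= n)%N ->
    let P := accept_prob A ((r ^t (m * (K ^ 2).+1)) *t (s ^t (m * K ^ 2))) in
    (1 - affinity r s <= a -> 2 / 3 <= P) /\ (a + e <= 1 - affinity r s -> 2 / 3 <= 1 - P).
Proof.
move=> K0 m0 /andP[e0 e1] herr hm.
have K0' : 0 < K%:R :> R by rewrite ltr0n.
have K1 : 1 <= K%:R :> R by rewrite ler1n.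
pose s : R := K%:R^-1; pose c : R := Num.sqrt (1 - s ^+ 2).
have s0 : 0 < s by rewrite invr_gt0.
have sK : s * K%:R = 1 by rewrite mulVf ?lt0r_neq0.
have s1 : s <= 1 by rewrite invf_le1.
have c0 : 0 <= c by apply: sqrtr_ge0.
have cs : c ^+ 2 + s ^+ 2 = 1 by rewrite sqr_sqrtr ?subrK // subr_ge0 exprn_ile1 // ltW.
have sN : s ^+ 2 * (K ^ 2)%:R = 1 by rewrite natrX -exprMn sK expr1n.
pose g := sqrt_approx c s (K ^ 2).
have hg : hull (K ^ 2) (fun x => (g x)%:C) 3 := hull_sqrt_approx cs c0 s0 sK.
have [f hf fg] : exists2 f, hull (K ^ 2) f (Num.sqrt s^-1) & forall x, (g x)%:C = x%:C * f x.
  exact: hull_sqrt_approx_quot cs c0 s0 sK.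
pose M : R := 3 * Num.sqrt K%:R.
have sM : Num.sqrt s^-1 * 3 = M by rewrite /s invrK mulrC.
have M3 : 3 <= M by rewrite /M -{1}[3]mulr1 ler_pM2l // -{1}[1]sqrtr1 ler_wsqrtr.
have M0 : 0 < M by lra.
have M2 : M ^+ 2 = 9 * K%:R by rewrite /M exprMn sqr_sqrtr ?ltW //; ring.
have := testable_observable M0 (eq_ind _ (observable _ _) (observable_spectral_form d hf hg) _ sM).
set p := (fun r0 s0 : 'M[Cplx]_d => 1 / 2 + _ / (2 * M)) => hp.
have gsp : state_space (probe d (K ^ 2)).
  by do 2 (apply: state_space_copies || apply: state_space_copy); apply: state_space_copies; exact: state_space_point.
(* The threshold is the success probability belonging to the midpoint 1 - a - e/2 of the two
   cases. *)
pose th : R := 1 / 2 + (1 - a - e / 2) / (2 * M).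
pose t : R := e / (8 * M).
have t0 : 0 < t by rewrite divr_gt0 // mulr_gt0.
have mt : 3 <= 4 * m%:R * t ^+ 2.
  rewrite /t expr_div_n exprMn M2 mulrA ler_pdivlMr; last by nra.
  by move: hm; move: (K%:R : R) (m%:R : R) (e ^+ 2) => x y z; lra.
have [A vA accA] := qalg_of_testable (testable_iso (iso_repeat_space m (iso_probe d (K ^ 2)))
   (testable_bin m (fun k => m%:R * th <= k%:R) gsp hp)).
exists A => // r0 s' dr ds rn sn P.
have E := spectral_form_err dr ds rn sn (mulr_ge0 (ler0n _ 4) (sqrtr_ge0 s)) _
  (fun x h => sqrt_approx_err cs c0 s0 sN h).
have {E} : `|\sum_i \sum_j g (eval r0 i ^+ 2) * g (eval s' j ^+ 2) * overlap r0 s' i j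
     - affinity r0 s'| <= e / 4.
  by apply: le_trans (E _) herr; rewrite /sqrt_approx mulr0 subrr mulr0.
rewrite -(Re_spectral_form r0 s' fg) => E.
have F0 := affinity_ge0 dr ds; have F1 := affinity_le1 dr ds.
move: (accA r0 s' dr ds); rewrite -/P /p => ->.
move: (complex.Re _) (affinity r0 s') E F0 F1 => B F + F0 F1.
rewrite ler_distl => /andP[B1 B2].
have pB x y : (x <= y) -> 1 / 2 + x / (2 * M) <= 1 / 2 + y / (2 * M).
  by move=> xy; rewrite lerD2l ler_pM2r // invr_gt0 mulr_gt0.
(* B is within e/4 of an affinity in [0, 1], so |B| <= M. *)
have p01 : 0 <= 1 / 2 + B / (2 * M) <= 1.
  have p1 : 1 / 2 + M / (2 * M) = 1 by field; rewrite lt0r_neq0.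
  have p0 : 1 / 2 + (- M) / (2 * M) = 0 by field; rewrite lt0r_neq0.
  by apply/andP; split; [rewrite -[X in X <= _]p0 | rewrite -[X in _ <= X]p1]; apply: pB; lra.
have [acc rej] := binmean_test th p01 m0 mt t0.
have tE : t = (e / 4) / (2 * M) by rewrite /t; field; rewrite lt0r_neq0.
split=> h; [apply: acc | apply: rej].
  by rewrite /th tE -addrA -mulrDl; apply: pB; lra.
by rewrite /th tE -addrA -mulrBl; apply: pB; lra.
Qed.

Lemma exists_nat_between (x : R) : 0 <= x -> exists2 k : nat, (0 < k)%N & x <= k%:R <= x + 1.
Proof.
move=> x0; exists (Num.truncn x).+1 => //.
have /andP[h1 h2] := truncn_itv x0.
by rewrite (ltW h2) -natr1 lerD2r.
Qed.

Lemma ln_ge_half (x : R) : 2 <= x -> 1 / 2 <= ln x.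
Proof.
move=> x2.
have two : IZR 2 = 2 by rewrite RealsE.
have h : Rle (ln (IZR 2)) (ln x).
  rewrite two; move: x2; rewrite le_eqVlt => /orP[/eqP <-|/RltP x2]; first exact: Rle_refl.
  by apply: Rlt_le; apply: ln_increasing => //; rewrite -two; exact: Rlt_0_2.
have h2 := Rlt_le _ _ ln_lt_2.
by move/RleP: (Rle_trans _ _ _ h2 h); rewrite two RealsE; lra.
Qed.

Lemma hellinger_boundE n (e : R) : hellinger_bound n e =
  (n%:R ^+ 3 * Num.sqrt n%:R) / e ^+ 20 * (ln (n%:R / e)) ^+ 4.
Proof. by []. Qed.

Lemma hellinger_bound_ge0 n e : 0 < e -> 0 <= hellinger_bound n e.
Proof.
move=> e0; rewrite hellinger_boundE mulr_ge0 //.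
  by rewrite divr_ge0 ?mulr_ge0 ?exprn_ge0 ?sqrtr_ge0 // ltW.
by rewrite (exprM _ 2 2) sqr_ge0.
Qed.

(** If n / e >= 2, the logarithm is at least 1/2 and the remaining powers dominate. Otherwise n = 1
    and e > 1/2; the logarithm may vanish, but the left side is at most 2^16 and the summand 1
    covers it. *)
Lemma cube_le_hellinger_bound (n : nat) (e : R) : (0 < n)%N -> 0 < e <= 1 ->
  n%:R ^+ 3 / e ^+ 16 <= 2 ^+ 16 * (hellinger_bound n e + 1).
Proof.
move=> n0 /andP[e0 e1]; have hb0 := hellinger_bound_ge0 n e0.
have n1 : 1 <= n%:R :> R by rewrite ler1n.
case: (lerP 2 (n%:R / e)) => h.
  have l4 : 1 / 16 <= ln (n%:R / e) ^+ 4.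
    have := ln_ge_half h; move: (ln _) => l l1.
    have -> : 1 / 16 = (1 / 2 : R) ^+ 4 by field.
    by rewrite lerXn2r ?nnegrE //; lra.
  have x0 : 0 <= n%:R ^+ 3 / e ^+ 16 by rewrite divr_ge0 ?exprn_ge0 // ltW.
  suff : n%:R ^+ 3 / e ^+ 16 * (1 / 16) <= hellinger_bound n e.
    move=> hb; apply: (@le_trans _ _ (16 * hellinger_bound n e)); first by lra.
    rewrite ler_pM //; last by lra.
    have -> : 16 = 2 ^+ 4 :> R by ring.
    by rewrite ler_weXn2l // ler1n.
  rewrite hellinger_boundE; apply: ler_pM => //; first by rewrite divr_ge0.
  apply: ler_pM; rewrite ?exprn_ge0 ?invr_ge0 ?exprn_ge0 ?(ltW e0) //.
    by rewrite ler_peMr ?exprn_ge0 // -{1}[1]sqrtr1 ler_wsqrtr.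
  rewrite lef_pV2 ?posrE ?exprn_gt0 //.
  by rewrite (exprD e 16 4) ler_piMr ?exprn_ge0 ?exprn_ile1 ?(ltW e0).
have n2 : n%:R < 2 :> R by move: h; rewrite ltr_pdivrMr //; lra.
have nE : n = 1%N by apply/eqP; rewrite eqn_leq n0 -ltnS andbT -(ltr_nat R).
have eh : 1 / 2 <= e by move: h; rewrite ltr_pdivrMr //; lra.
apply: (@le_trans _ _ (2 ^+ 16)); last by rewrite ler_peMr ?exprn_ge0 // lerDr.
rewrite nE expr1n ler_pdivrMr ?exprn_gt0 // -exprMn.
by rewrite exprn_ege1 //; lra.
Qed.

Lemma density_rank_gt0 d (r : 'M[Cplx]_d) : density r -> (0 < \rank r)%N.
Proof.
move=> [_ tr1]; rewrite lt0n mxrank_eq0; apply/eqP => r0.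
by move: tr1; rewrite r0 mxtrace0 => /esym/eqP; rewrite oner_eq0.
Qed.

(** For negative x the root is 0 by convention, and the bound is then trivial. *)
Lemma sqrt_le_sqr (x e : R) : 0 <= e -> Num.sqrt x <= e -> x <= e ^+ 2.
Proof.
move=> e0 h; case: (lerP 0 x) => x0; last by apply: le_trans (ltW x0) (sqr_ge0 e).
by rewrite -(sqr_sqrtr x0) ler_sqr ?nnegrE ?sqrtr_ge0.
Qed.

Lemma sqr_le_sqrt (x e : R) : 0 < e -> e <= Num.sqrt x -> e ^+ 2 <= x.
Proof.
move=> e0 h; have x0 : 0 < x by rewrite -sqrtr_gt0; apply: lt_le_trans h.
by rewrite -[x](sqr_sqrtr (ltW x0)) ler_sqr ?nnegrE ?sqrtr_ge0 // ltW.
Qed.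

Bind Scope R_scope with R.

Theorem mainTheorem10 :
  exists c : R, 0 < c /\
  forall (d r : nat) (eps1 eps2 : R), 0 <= eps1 -> eps1 < eps2 ->
  exists (k l : nat),
    (k + l)%:R <= c * (hellinger_bound r (eps2 - eps1) + 1) /\
    exists A : qalg (d ^ k * d ^ l),
      qalg_valid A /\
      forall rho sigma : 'M[Cplx]_d,
        density rho -> density sigma ->
        (\rank rho <= r)%N -> (\rank sigma <= r)%N ->
        (hellinger rho sigma <= eps1 ->
           2 / 3 <= accept_prob A ((rho ^t k) *t (sigma ^t l))) /\
        (eps2 <= hellinger rho sigma ->
           2 / 3 <= 1 - accept_prob A ((rho ^t k) *t (sigma ^t l))).
Proof.
(* At most 3 m K^2 copies are used, with m e^4 <= 2^10 K and K e^4 <= 2^13 r. The further factor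
   2^16 comes from [cube_le_hellinger_bound]. *)
pose C : R := (3 * 2 ^+ 10 * (2 ^+ 13) ^+ 3)%R.
have C0 : 0 < C by rewrite /C !mulr_gt0 // !exprn_gt0.
exists (C * 2 ^+ 16); split; first by rewrite mulr_gt0 // exprn_gt0.
move=> d r eps1 eps2 e10 e12.
pose e := eps2 - eps1; have e0 : 0 < e by rewrite subr_gt0.
(* In the statement this difference is parsed in the scope of Stdlib's reals; it is convertible to
   e. *)
rewrite -[Rminus eps2 eps1]/e.
(* If r = 0 there are no states, and if eps2 > 1 the far case is impossible because the distance is
   at most 1. Accepting always, without samples, is then correct. *)
case: (boolP ((r == 0%N) || (1 < eps2))) => [triv|].
  exists 0%N, 0%N; split.
    by rewrite mulr_ge0 ?addr_ge0 ?hellinger_bound_ge0 // mulr_ge0 ?exprn_ge0 // ltW.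
  have [A vA accA] := qalg_of_testable (testable_iso (iso_samples0 d) (testable1 (@state_space_point d))).
  exists A; split=> // rho sigma dr ds rr sr; rewrite accA //; split=> [_|]; first by lra.
  move: triv => /orP[/eqP r0|e2].
    by move: (density_rank_gt0 dr); rewrite ltnNge (leq_trans rr) // r0.
  have e20 : 0 < eps2 by lra.
  rewrite hellingerE // => /(sqr_le_sqrt e20); have := affinity_ge0 dr ds; nra.
rewrite negb_or -lt0n -leNgt => /andP[r0 e2].
have e1 : e <= 1 by rewrite /e; lra.
pose n : R := r%:R; have n1 : 1 <= n by rewrite ler1n.
have e4 : 0 < e ^+ 4 by rewrite exprn_gt0.
have e41 : e ^+ 4 <= 1 by rewrite exprn_ile1 // ltW.
(* This K makes √(r / K) at most e^2 / 64. Below, m uses 2^9 >= 432, and e^4 appears because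
   [affinity_test] is run with gap e^2. *)
have [K K0 /andP[K1 K2]] : exists2 K : nat, (0 < K)%N & 2 ^+ 12 * n / e ^+ 4 <= K%:R <= 2 ^+ 12 * n / e ^+ 4 + 1.
  by apply: exists_nat_between; rewrite divr_ge0 ?mulr_ge0 ?exprn_ge0 ?(ltW e0).
have K0' : 0 < K%:R :> R by rewrite ltr0n.
have Kr1 : 1 <= K%:R :> R by rewrite ler1n.
have [m m0 /andP[m1 m2]] : exists2 m : nat, (0 < m)%N & 2 ^+ 9 * K%:R / e ^+ 4 <= m%:R <= 2 ^+ 9 * K%:R / e ^+ 4 + 1.
  by apply: exists_nat_between; rewrite divr_ge0 ?mulr_ge0 // ltW.
exists (m * (K ^ 2).+1)%N, (m * K ^ 2)%N; split.
  have -> : (m * (K ^ 2).+1 + m * K ^ 2)%N%:R = m%:R * (2 * K%:R ^+ 2 + 1) :> R.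
    by rewrite natrD !natrM -natr1 natrX; ring.
  have dbl (j : nat) (x y : R) : 1 <= x -> y <= 2 ^+ j * x / e ^+ 4 + 1 ->
      y * e ^+ 4 <= 2 ^+ j.+1 * x.
    (* Rounding up costs at most a factor 2, since e^4 <= 1 <= 2^j x. *)
    move=> x1; rewrite -(ler_pM2r e4) mulrDl mulfVK ?lt0r_neq0 // mul1r.
    move=> /le_trans; apply; rewrite (exprS 2 j); have : 1 <= 2 ^+ j * x :> R.
      by apply: mulr_ege1 => //; apply: exprn_ege1; rewrite ler1n.
    by rewrite -mulrA; move: (2 ^+ j * x) => w w1; lra.
  have K3 := dbl _ _ _ n1 K2; have m3 := dbl _ _ _ Kr1 m2.
  rewrite -mulrA; apply: le_trans (ler_wpM2l (ltW C0) (cube_le_hellinger_bound r0 _)); last first.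
    by rewrite e0 e1.
  rewrite (mulrA C) ler_pdivlMr ?exprn_gt0 // (exprM e 4 4).
  move: (e ^+ 4) e4 {e41 K1 K2 m1 m2} K3 m3 => q q0 K3 m3.
  have s1 : m%:R * (2 * K%:R ^+ 2 + 1) * q ^+ 4 <= 3 * (m%:R * q) * (K%:R ^+ 2 * q ^+ 3).
    have -> : 3 * (m%:R * q) * (K%:R ^+ 2 * q ^+ 3) = m%:R * (3 * K%:R ^+ 2) * q ^+ 4 by ring.
    rewrite ler_wpM2r ?exprn_ge0 ?(ltW q0) // ler_wpM2l //; nra.
  apply: le_trans s1 _.
  have s2 : 3 * (m%:R * q) * (K%:R ^+ 2 * q ^+ 3) <= 3 * 2 ^+ 10 * (K%:R * q) ^+ 3.
    have -> : 3 * 2 ^+ 10 * (K%:R * q) ^+ 3 = 3 * (2 ^+ 10 * K%:R) * (K%:R ^+ 2 * q ^+ 3) by ring.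
    by rewrite ler_wpM2r ?mulr_ge0 ?exprn_ge0 ?(ltW q0) // ler_pM2l.
  apply: le_trans s2 _; have -> : C * r%:R ^+ 3 = 3 * 2 ^+ 10 * (2 ^+ 13 * n) ^+ 3.
    by rewrite (exprMn 3 (2 ^+ 13) n) [RHS]mulrA.
  rewrite ler_pM2l ?mulr_gt0 ?exprn_gt0 //.
  by rewrite lerXn2r ?nnegrE ?mulr_ge0 ?exprn_ge0 ?(ltW q0).
have ee : 0 < e ^+ 2 <= 1 by rewrite exprn_gt0 // exprn_ile1 // ltW.
have [||A vA accA] := @affinity_test d r K m (eps1 ^+ 2) (e ^+ 2) K0 m0 ee.
- have q1 : n / K%:R <= (e ^+ 2 / 64) ^+ 2.
    rewrite ler_pdivrMr // expr_div_n -exprM.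
    by move: K1; rewrite ler_pdivrMr //; lra.
  have q2 : Num.sqrt K%:R^-1 * Num.sqrt n <= e ^+ 2 / 64.
    rewrite -sqrtrM ?invr_ge0 // mulrC -[X in _ <= X]ger0_norm ?divr_ge0 ?sqr_ge0 //.
    by rewrite -sqrtr_sqr ler_wsqrtr.
  have -> : 4 * Num.sqrt K%:R^-1 * (2 * Num.sqrt r%:R + r%:R * (4 * Num.sqrt K%:R^-1)) =
     8 * (Num.sqrt K%:R^-1 * Num.sqrt n) + 16 * (n * Num.sqrt K%:R^-1 ^+ 2) by rewrite /n; ring.
  rewrite sqr_sqrtr ?invr_ge0 //.
  (* The total is at most e^2 / 8 + e^2 / 256, below the required e^2 / 4. *)
  have q3 : (e ^+ 2 / 64) ^+ 2 <= e ^+ 2 / 64 * (1 / 64) by have := ee => /andP[]; nra.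
  by have := ee => /andP[]; lra.
- move: m1; rewrite -exprM ler_pdivrMr //; apply: le_trans.
  by rewrite ler_pM2r // -natrX ler_nat.
exists A; split=> // rho sigma dr ds rr sr; have [acc rej] := accA rho sigma dr ds rr sr.
rewrite hellingerE //; split=> [/(sqrt_le_sqr e10) //|h]; apply: rej.
have e20 : 0 < eps2 by lra.
(* With eps1 and e nonnegative, eps1^2 + e^2 <= (eps1 + e)^2 = eps2^2. *)
by apply: le_trans (sqr_le_sqrt e20 h); rewrite /e; nra.
Qed.
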